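(* Let $K$ be a Lie group modeled on a locally convex space, let $M$ be a finite-dimensional connected paracompact manifold with corners, and let $\mathcal{P}=(K,\eta:P\to M)$ be a continuous principal $K$-bundle over $M$. If $C\subseteq M$ is closed and the restriction of $\mathcal{P}$ to some open neighborhood of $C$ is smooth, then there exists an open neighborhood $T$ of $C$ such that the restriction $\mathcal{P}|_T$ extends to a smooth principal $K$-bundle $\widetilde{\mathcal{P}}$ over $M$ (with total space $\widetilde P$), in the sense that $\mathcal{P}|_T$ is a $K$-invariant open subset of $\widetilde{\mathcal{P}}$ and the $K$-action and bundle projection of $\mathcal{P}|_T$ extend to those of $\widetilde{\mathcal{P}}$. Furthermore, there exists a continuous bundle equivalence $\Omega:P\to\widetilde P$ which restricts to the identity on $\eta^{-1}(T)$.
   Context: Calculus. Locally convex spaces are real and Hausdorff. For $E,F$ locally convex and $U\subseteq E$ open, a map $f:U\to F$ is $C^1$ if it is continuous, $df(x).v:=\lim_{h\to 0}\frac1h(f(x+hv)-f(x))$ exists for all $x\in U$, $v\in E$, and $df:U\times E\to F$ is continuous. Recursively, $d^{n}f(x).(v_1,\dots,v_n):=\lim_{h\to0}\frac1h\big(d^{n-1}f(x+hv_n).(v_1,\dots,v_{n-1})-d^{n-1}f(x).(v_1,\dots,v_{n-1})\big)$; $f$ is $C^n$ if $d^kf:U\times E^k\to F$ exists and is continuous for $k=1,\dots,n$, and smooth if it is $C^n$ for all $n$. A Lie group modeled on a locally convex space is a group that is a smooth manifold modeled on a locally convex space with smooth group operations. Manifolds with corners. A map $f:A\to E$ from a (not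 necessarily open) subset $A\subseteq\mathbb{R}^n$ is smooth if each $x\in A$ has an open neighborhood $U_x$ in $\mathbb{R}^n$ and a smooth map $f_x:U_x\to E$ agreeing with $f$ on $A\cap U_x$. A $d$-dimensional manifold with corners is a paracompact Hausdorff space in which each point has a neighborhood homeomorphic to an open subset of $\mathbb{R}^d_+=\{x\in\mathbb{R}^d:x_i\ge0 \text{ for all } i\}$, with smooth coordinate changes. Bundles. A continuous principal $K$-bundle over $M$ is a topological space $P$ with a continuous right action $P\times K\to P$ and a map $\eta:P\to M$ such that there are an open cover $(U_i)_{i\in I}$ of $M$ (a locally trivial cover) and homeomorphisms (local trivializations) $\Omega_i:\eta^{-1}(U_i)\to U_i\times K$ with $\mathrm{pr}_1\circ\Omega_i=\eta|_{\eta^{-1}(U_i)}$ and $\Omega_i(p\cdot k)=\Omega_i(p)\cdot k$, where $K$ acts on $U_i\times K$ by right multiplication on the second factor. The transition functions $k_{ij}:U_i\cap U_j\to K$ are the continuous maps given by $\Omega_i^{-1}(x,e)\cdot k_{ij}(x)=\Omega_j^{-1}(x,e)$. The bundle is smooth if the transition functions are smooth for some choice of local trivializations; then $P$ carries the smooth structure for which these $\Omega_i$ are diffeomorphisms. For open $T\subseteq M$, $\mathcal{P}|_T$ is the bundle $\eta^{-1}(T)\to T$. A continuous bundle map $\Omega:P\to P'$ is a continuous map with $\Omega(p\cdot k)=\Omega(p)\cdot k$; it is a continuous bundle equivalence if it is an isomorphism inducing $\mathrm{id}_M$ on $M$. *)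

(* Defs.v *)
(* The reals are an arbitrary [R : realType] and real locally convex spaces are
   [E : tvsType R] with [hausdorff_space E]. *)
From HB Require Import structures.
From mathcomp Require Import all_boot all_order all_algebra.
From mathcomp Require Import all_classical reals topology tvs normedtype.

Set Implicit Arguments.
Unset Strict Implicit.
Unset Printing Implicit Defensive.

Import Order.TTheory GRing.Theory Num.Theory.
Import numFieldNormedType.Exports.

Local Open Scope classical_set_scope.
Local Open Scope ring_scope.

(** ** Differential calculus

  A map defined on U is given by a total function. In [Cn] and [smooth_on] the
  set U is meant to be open, so that the limits at points of U do not depend on
  the values taken outside U. *)

Section Calculus.
Context {R : realType} {E F : tvsType R}.

Definition diff_quotient (f : E -> F) (x v : E) (h : R) : F :=
  h^-1 *: (f (x + h *: v) - f x).

(* The library's [derive], [derivable] and [lim] are not available on a [tvsType],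
   which need not be a normed module nor be declared pointed. *)
Definition is_ddir (f : E -> F) (x v : E) (l : F) : Prop :=
  diff_quotient f x v h @[h --> 0^'] --> l.

Definition ddir (f : E -> F) (x v : E) : F := xget 0 (is_ddir f x v).

Definition forget_last (k : nat) (v : 'I_k.+1 -> E) (i : 'I_k) : E :=
  v (widen_ord (leqnSn k) i).

(* [diffn f k x v] is d^k f(x).(v_1,...,v_k), with v_i written [v (i - 1)]. It is
   meaningful only where the limits involved exist, as required in [Cn]. *)
Fixpoint diffn (f : E -> F) (k : nat) : E -> ('I_k -> E) -> F :=
  match k return E -> ('I_k -> E) -> F with
  | 0 => fun x _ => f x
  | k'.+1 => fun x v =>
      ddir (fun y => diffn f y (forget_last v)) x (v ord_max)
  end.

Definition Cn (n : nat) (U : set E) (f : E -> F) : Prop :=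
  {within U, continuous f} /\
  forall k, (k < n)%N ->
    (forall x (v : 'I_k.+1 -> E), U x ->
       exists l, is_ddir (fun y => diffn f y (forget_last v)) x (v ord_max) l) /\
    {within U `*` setT,
      continuous (fun p : E * prod_topology (fun _ : 'I_k.+1 => E) =>
                    diffn f p.1 p.2)}.

Definition smooth_on (U : set E) (f : E -> F) : Prop := forall n, Cn n U f.

(* Smoothness on a not necessarily open set; used for E = R^d only. *)
Definition smooth_sub (A : set E) (f : E -> F) : Prop :=
  forall x, A x -> exists (U : set E) (g : E -> F),
    [/\ open U, U x, smooth_on U g & forall y, A y -> U y -> g y = f y].

End Calculus.

(** ** Charts and atlases *)

Definition homeo_on (X Y : topologicalType) (A : set X) (B : set Y)
    (f : X -> Y) (g : Y -> X) : Prop :=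
  [/\ forall x, A x -> B (f x) /\ g (f x) = x,
      forall y, B y -> A (g y) /\ f (g y) = y,
      {within A, continuous f} & {within B, continuous g}].

Record chart (X Y : Type) := Chart {
  cdom : set X;
  cmap : X -> Y;
  cinv : Y -> X }.

Definition ccod (X Y : Type) (c : chart X Y) : set Y := cmap c @` cdom c.

Definition is_chart (X Y : topologicalType) (Y0 : set Y) (c : chart X Y) : Prop :=
  [/\ open (cdom c),
      exists2 O : set Y, open O & ccod c = O `&` Y0
    & homeo_on (cdom c) (ccod c) (cmap c) (cinv c)].

(* [Y0] is the model ([setT] or R^d_+) and [sm] the notion of smoothness for maps
   between subsets of the model space. *)
Definition smooth_atlas (X Y : topologicalType) (Y0 : set Y)
    (sm : set Y -> (Y -> Y) -> Prop) (A : set (chart X Y)) : Prop :=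
  [/\ forall c, A c -> is_chart Y0 c,
      forall x, exists2 c, A c & cdom c x
    & forall c c', A c -> A c' ->
        sm (cmap c @` (cdom c `&` cdom c')) (cmap c' \o cinv c)].

(* Smoothness on the open set U of f : X -> X' read in the atlases A and A'. *)
Definition smooth_map (X X' : topologicalType) (Y Y' : Type)
    (sm : set Y -> (Y -> Y') -> Prop)
    (A : set (chart X Y)) (A' : set (chart X' Y')) (U : set X) (f : X -> X') : Prop :=
  {within U, continuous f} /\
  forall c c', A c -> A' c' ->
    sm (cmap c @` (cdom c `&` U `&` f @^-1` cdom c')) (cmap c' \o f \o cinv c).

Definition prod_chart (X X' Y Y' : Type) (c : chart X Y) (c' : chart X' Y') :
    chart (X * X') (Y * Y') :=
  {| cdom := cdom c `*` cdom c';
     cmap := fun x => (cmap c x.1, cmap c' x.2);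
     cinv := fun y => (cinv c y.1, cinv c' y.2) |}.

Definition prod_atlas (X X' Y Y' : Type) (A : set (chart X Y))
    (A' : set (chart X' Y')) : set (chart (X * X') (Y * Y')) :=
  [set prod_chart c.1 c.2 | c in A `*` A'].

(** ** Lie groups *)

(* No compatibility of the group law with the topology here: it is a consequence
   of [lie_group]. *)
#[short(type="preTopologicalGroupType")]
HB.structure Definition PreTopologicalGroup := {K of Group K & Topological K}.

Definition lie_group (R : realType) (E : tvsType R) (K : preTopologicalGroupType)
    (A : set (chart K E)) : Prop :=
  [/\ hausdorff_space E, hausdorff_space K, smooth_atlas setT smooth_on A,
      smooth_map smooth_on (prod_atlas A A) A setT (fun x : K * K => (x.1 * x.2)%g)
    & smooth_map smooth_on A A setT (fun x : K => (x^-1)%g)].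

(** ** Manifolds with corners *)

Definition paracompact (X : topologicalType) : Prop :=
  forall U : set (set X), U `<=` open -> (forall x, exists2 A, U A & A x) ->
  exists V : set (set X),
    [/\ V `<=` open,
        forall x, exists2 B, V B & B x,
        forall B, V B -> exists2 A, U A & B `<=` A
      & forall x : X, exists2 N, nbhs x N
                  & finite_set [set B | V B /\ B `&` N !=set0]].

Definition corner (R : realType) (d : nat) : set 'rV[R]_d :=
  [set x | forall i, 0 <= x ord0 i].

Definition manifold_with_corners (R : realType) (d : nat) (M : topologicalType)
    (A : set (chart M 'rV[R]_d)) : Prop :=
  [/\ paracompact M, hausdorff_space M & smooth_atlas (@corner R d) smooth_sub A].

(** ** Principal bundles *)

Section Bundles.
Context {K : preTopologicalGroupType} {M : topologicalType}.

(* A local trivialization eta^-1(U) -> U x K together with its inverse, as total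
   functions. *)
Record loc_triv (P : Type) := LocTriv {
  tdom : set M;
  tmap : P -> M * K;
  tinv : M * K -> P }.

Definition is_loc_triv (P : topologicalType) (bact : P -> K -> P) (bproj : P -> M)
    (t : loc_triv P) : Prop :=
  [/\ open (tdom t),
      homeo_on (bproj @^-1` tdom t) (tdom t `*` setT) (tmap t) (tinv t),
      forall p, tdom t (bproj p) -> (tmap t p).1 = bproj p
    & forall p k, tdom t (bproj p) ->
        tmap t (bact p k) = ((tmap t p).1, ((tmap t p).2 * k)%g)].

(* The local trivializations in L are those of the bundle restricted to V. *)
Definition trivializes (P : topologicalType) (bact : P -> K -> P) (bproj : P -> M)
    (V : set M) (L : set (loc_triv P)) : Prop :=
  [/\ forall t, L t -> is_loc_triv bact bproj t,
      forall t, L t -> tdom t `<=` V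
    & forall x, V x -> exists2 t, L t & tdom t x].

(* [bproj_bact] is what makes sense of the equivariance in [is_loc_triv]: since
   [tmap] is total, it does not force p.k to stay in eta^-1(U). *)
Record principal_bundle := PrincipalBundle {
  bundle_total :> topologicalType;
  bact : bundle_total -> K -> bundle_total;
  bproj : bundle_total -> M;
  bact1 : forall p, bact p 1%g = p;
  bactM : forall p k k', bact (bact p k) k' = bact p (k * k')%g;
  bact_continuous : continuous (fun pk : bundle_total * K => bact pk.1 pk.2);
  bproj_bact : forall p k, bproj (bact p k) = bproj p;
  loc_trivial : exists L, trivializes bact bproj setT L }.

(* The point Omega^-1(x, e). *)
Definition tsec (P : Type) (t : loc_triv P) (x : M) : P := tinv t (x, 1%g).

(* The transition function between t and t' over W, for a local trivialization t
   of P viewed in Q through [iota : P -> Q] and a local trivialization t' of Q,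
   is smooth. *)
Definition smooth_transition (R : realType) (E : tvsType R) (d : nat)
    (AM : set (chart M 'rV[R]_d)) (AK : set (chart K E))
    (P Q : principal_bundle) (iota : P -> Q) (W : set M)
    (t : loc_triv P) (t' : loc_triv Q) : Prop :=
  exists2 k : M -> K,
    forall x, W x -> bact (iota (tsec t x)) (k x) = tsec t' x
  & smooth_map smooth_sub AM AK W k.

(* L makes the restriction of P to the open set V a smooth bundle. *)
Definition smooth_bundle_on (R : realType) (E : tvsType R) (d : nat)
    (AM : set (chart M 'rV[R]_d)) (AK : set (chart K E))
    (P : principal_bundle) (V : set M) (L : set (loc_triv P)) : Prop :=
  trivializes (@bact P) (@bproj P) V L /\
  forall t t', L t -> L t' ->
    smooth_transition AM AK (idfun : P -> P) (tdom t `&` tdom t') t t'.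

Definition open_embedding_on (X Y : topologicalType) (A : set X) (f : X -> Y) :
    Prop :=
  [/\ {in A &, injective f}, {within A, continuous f}
    & forall W, open W -> W `<=` A -> open (f @` W)].

(* [iota] identifies the restriction of P to T with a K-invariant open subset of Q,
   compatibly with actions, projections, and the smooth structures given by LP
   and LQ: these structures coincide on eta^-1(T) when the trivializations in LP
   and in LQ are related by smooth transition functions. *)
Definition extends_restriction (R : realType) (E : tvsType R) (d : nat)
    (AM : set (chart M 'rV[R]_d)) (AK : set (chart K E))
    (P Q : principal_bundle) (T : set M)
    (LP : set (loc_triv P)) (LQ : set (loc_triv Q)) (iota : P -> Q) : Prop :=
  [/\ open_embedding_on (@bproj P @^-1` T) iota,
      forall q k, (iota @` (@bproj P @^-1` T)) q ->
        (iota @` (@bproj P @^-1` T)) (bact q k),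
      forall p k, T (bproj p) -> iota (bact p k) = bact (iota p) k,
      forall p, T (bproj p) -> bproj (iota p) = bproj p
    & forall t t', LP t -> LQ t' ->
        smooth_transition AM AK iota (T `&` tdom t `&` tdom t') t t'].

Definition bundle_map (P Q : principal_bundle) (Omega : P -> Q) : Prop :=
  continuous Omega /\ forall p k, Omega (bact p k) = bact (Omega p) k.

Definition bundle_equivalence (P Q : principal_bundle) (Omega : P -> Q) : Prop :=
  [/\ bundle_map Omega,
      exists Omega' : Q -> P,
        [/\ bundle_map Omega', cancel Omega Omega' & cancel Omega' Omega]
    & forall p, bproj (Omega p) = bproj p].

End Bundles.

Arguments loc_triv : clear implicits.
Arguments principal_bundle : clear implicits.

(* Main.v *)
Require Import Defs.
From HB Require Import structures.
From mathcomp Require Import all_boot all_order all_algebra.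
From mathcomp Require Import all_classical reals topology tvs normedtype.
From mathcomp Require Import interval_inference sequences derive realfun exp ring.

Set Implicit Arguments.
Unset Strict Implicit.
Unset Printing Implicit Defensive.

Import Order.TTheory GRing.Theory Num.Theory.
Import numFieldNormedType.Exports.

Local Open Scope classical_set_scope.
Local Open Scope ring_scope.

(** The smooth bundle may be taken to be P itself: transporting a smooth structure
    back along a continuous equivalence, one sees that the theorem asks for a smooth
    structure on P which agrees with the given one over an open neighborhood T of C.
    Both the bundle map and the embedding are then the identity.

    A smooth structure is recorded by local sections: one continuous section sigma x
    near each point x, such that sigma x and sigma y differ by a smooth K-valued
    function near y when y is close to x. This makes sense along a set A that need
    not be open ([smooth_str]), all conditions being on germs at points of A. Closed
    sets are the useful ones. If P has a smooth structure along a closed set A, and F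
    is a compact set inside the domain of a trivialization, the structure extends to
    the union of A and F as soon as the section tau given by the trivialization can be
    replaced by one which is smooth at the points of A in F ([extend_str]); no
    neighborhood has to shrink. Choosing T with closure in V, the structure given by L
    lives along the closure of T, and Zorn's lemma over a locally finite cover of M by
    sets with compact closure extends it to M ([extend_str_all]).

    The heart is therefore the smoothing of a continuous section along a compact set
    X on which a smooth structure is given ([smooth_section]). Near a point of X,
    written as s . f with s smooth, the section becomes a function f into K, and f
    can be read in a chart of K, with values in a convex open set of E. There one
    contracts: replace f by (1 - b) f + b e, where b is a smooth plateau function and
    e is the value of f at one point. The result is constant, hence smooth, where
    b = 1; it is smooth wherever f was; and it is unchanged outside the support of b
    ([contract_section]). Convexity keeps the values in a prescribed neighborhood of
    those of f, so finitely many contractions make f smooth along a compact set while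
    moving it as little as desired ([smooth_in_chart]). Smallness matters because the
    finitely many charts of K used along X are chosen for the original section, and
    have to remain usable for the modified ones.

    The calculus behind this is that of maps between locally convex spaces all of
    whose iterated differentials exist and are continuous. The chain rule is proved
    for an equivalent notion ([Ck]) that is iterated on the tangent map; the passage
    from the iterated differentials to [Ck] rests on a mean value inclusion and on
    the multilinearity of the differentials ([Ck_diffn_comp]), the converse is
    [Ck_smooth_on]. *)

(** * Limits and convex neighborhoods in locally convex spaces *)

Section LocallyConvex.
Context {R : realType}.

Lemma cvg_addv (F : tvsType R) T (G : set_system T) {FG : Filter G}
  (f g : T -> F) (a b : F) :
  f x @[x --> G] --> a -> g x @[x --> G] --> b ->
  (f x + g x) @[x --> G] --> a + b.
Proof.
move=> fa gb.
apply: (cvg_comp (fun x => (f x, g x)) (fun p : F * F => p.1 + p.2)); last first.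
  exact: (@add_continuous F (a, b)).
exact: cvg_pair.
Qed.

Lemma cvg_scalev (F : tvsType R) T (G : set_system T) {FG : Filter G}
  (k : T -> R) (g : T -> F) (a : R) (b : F) :
  k x @[x --> G] --> a -> g x @[x --> G] --> b ->
  (k x *: g x) @[x --> G] --> a *: b.
Proof.
move=> fa gb.
apply: (cvg_comp (fun x => (k x, g x)) (fun p : R^o * F => p.1 *: p.2));
  last exact: (@scale_continuous R F (a, b)).
exact: (@cvg_pair _ _ _ _ (nbhs (a : R^o)) (nbhs b)).
Qed.

Lemma cvg_oppv (F : tvsType R) T (G : set_system T) {FG : Filter G}
  (g : T -> F) (b : F) :
  g x @[x --> G] --> b -> (- g x) @[x --> G] --> - b.
Proof.
move=> gb; rewrite -scaleN1r.
under eq_fun do rewrite -scaleN1r.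
by apply: cvg_scalev => //; exact: cvg_cst.
Qed.

Lemma cvg_subv (F : tvsType R) T (G : set_system T) {FG : Filter G}
  (f g : T -> F) (a b : F) :
  f x @[x --> G] --> a -> g x @[x --> G] --> b ->
  (f x - g x) @[x --> G] --> a - b.
Proof. by move=> fa gb; apply: cvg_addv => //; exact: cvg_oppv. Qed.

Lemma cvg_sumv (F : tvsType R) T (G : set_system T) {FG : Filter G} (I : Type)
  (r : seq I) (f : I -> T -> F) (a : I -> F) :
  (forall i, f i x @[x --> G] --> a i) ->
  (\sum_(i <- r) f i x) @[x --> G] --> \sum_(i <- r) a i.
Proof.
move=> fa; elim: r => [|i r IH].
  by rewrite big_nil; under eq_fun do rewrite big_nil; exact: cvg_cst.
rewrite big_cons; under eq_fun do rewrite big_cons.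
by apply: cvg_addv; [exact: fa|exact: IH].
Qed.

Lemma cvg_addZ0 (F : tvsType R) T (G : set_system T) {FG : Filter G}
  (k : T -> R) (f g : T -> F) (a b : F) :
  f x @[x --> G] --> a -> k x @[x --> G] --> 0 -> g x @[x --> G] --> b ->
  (f x + k x *: g x) @[x --> G] --> a.
Proof.
move=> fa k0 gb; rewrite -[a in X in _ --> X]addr0 -[0](scale0r b).
exact: cvg_addv fa (cvg_scalev k0 gb).
Qed.

(** Convexity with an explicit real coefficient: the predicate behind the local
    convexity of a [tvsType] is stated on an alias of the space, with coefficients in a
    subtype of the reals. *)
Definition cvx (F : lmodType R) (C : set F) : Prop :=
  forall x y (t : R), 0 <= t <= 1 -> C x -> C y -> C ((1 - t) *: x + t *: y).

Lemma open_cvx_nbhs (F : tvsType R) (x : F) (N : set F) : nbhs x N ->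
  exists C : set F, [/\ open C, cvx C, C x & C `<=` N].
Proof.
move=> Nx; have [B Bc [Bo Bb]] := @locally_convex R F.
have [C /= [BC Cx] CN] := Bb x N Nx.
exists C; split=> //; first exact: Bo.
move=> y z t /andP[t0 t1] Cy Cz.
have := Bc C (mem_set BC) z y (Itv01 t0 t1) (mem_set Cz) (mem_set Cy).
rewrite inE; congr C.
by rewrite [RHS]addrC.
Qed.
End LocallyConvex.

(** * Mean value inclusion and strict differentiability *)

Section MeanValue.
Context {R : realType}.

(** If the difference quotients of g over [a, b] and [b, c] lie in C, so does the one
    over [a, c], which is a convex combination of them. The openness of C gives
    quotients in C near each point, and a supremum argument reaches 1 from 0. *)
Lemma mean_value (F : tvsType R) (g : R -> F) (C : set F) :
  open C -> cvx C ->
  (forall t, 0 <= t <= 1 -> exists2 l, C l &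
     h^-1 *: (g (t + h) - g t) @[h --> (0:R)^'] --> l) ->
  C (g 1 - g 0).
Proof.
move=> Co Cc dg.
pose q a b := (b - a)^-1 *: (g b - g a).
have q_cvx a b c : a < b -> b < c -> C (q a b) -> C (q b c) -> C (q a c).
  move=> ab bc Cab Cbc.
  have ac : a < c by exact: lt_trans bc.
  have ac0 : c - a != 0 by rewrite subr_eq0 gt_eqF.
  have ab0 : b - a != 0 by rewrite subr_eq0 gt_eqF.
  have bc0 : c - b != 0 by rewrite subr_eq0 gt_eqF.
  have -> : q a c = (1 - (c - b) / (c - a)) *: q a b
      + ((c - b) / (c - a)) *: q b c.
    rewrite /q !scalerA.
    have -> : (1 - (c - b) / (c - a)) / (b - a) = (c - a)^-1 by field; apply/andP.
    have -> : (c - b) / (c - a) / (c - b) = (c - a)^-1 by field; apply/andP.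
    by rewrite -scalerDr; congr (_ *: _); rewrite [RHS]addrC addrA subrK.
  apply: Cc => //; apply/andP; split.
    by rewrite divr_ge0// subr_ge0 ltW.
  by rewrite ler_pdivrMr ?subr_gt0// mul1r lerB// ltW.
(* near each point of the interval the difference quotients already lie in C *)
have loc t : 0 <= t <= 1 -> exists2 e, 0 < e &
    (forall a, t - e < a < t -> C (q a t)) /\
    (forall b, t < b < t + e -> C (q t b)).
  move=> t01; have [l Cl] := dg _ t01 => /(_ C (open_nbhs_nbhs (conj Co Cl))).
  rewrite /= !near_simpl => /nbhs_ballP[e /= e0 He].
  exists e => //; split=> [a /andP[ta at']|b /andP[tb bt]].
    have := He (a - t); rewrite /ball /= sub0r normrN ltr0_norm ?subr_lt0//.
    rewrite opprB ltrBlDl -ltrBlDr => /(_ ta).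
    rewrite subr_eq0 lt_eqF// => /(_ isT).
    by rewrite (addrC t) subrK /q -(opprB a) invrN scaleNr -scalerN opprB.
  have := He (b - t); rewrite /ball /= sub0r normrN gtr0_norm ?subr_gt0//.
  rewrite ltrBlDl => /(_ bt); rewrite subr_eq0 gt_eqF// => /(_ isT).
  by rewrite (addrC t) subrK.
pose S := [set t | 0 <= t <= 1 /\ (t = 0 \/ C (q 0 t))].
have S0 : S 0 by split; [rewrite lexx ler01|left].
have Sub : ubound S 1 by move=> t [/andP[]].
have hsS : has_sup S by split; [exists 0|exists 1].
pose s := sup S.
have s01 : 0 <= s <= 1.
  by rewrite (ub_le_sup hsS.2 S0)//=; apply: ge_sup => //; exists 0.
have [e e0 [el er]] := loc _ s01.
(* S is closed under taking the supremum, which then cannot be smaller than 1 *)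
have Ss : S s.
  have [t St set_] := sup_adherent e0 hsS.
  have [<-//|ts] := eqVneq t s.
  have {}ts : t < s by rewrite lt_neqAle ts; exact: (ub_le_sup hsS.2 St).
  split=> //; right.
  have Cts : C (q t s) by apply: el; rewrite set_ ts.
  case: St => /andP[t0 t1] [t0E|Ct]; first by rewrite -t0E.
  have [t0E|t0N] := eqVneq t 0; first by rewrite -t0E.
  by apply: q_cvx Ct Cts => //; rewrite lt_neqAle eq_sym t0N.
have s1 : s = 1.
  apply/eqP; case/andP: s01 => s0; rewrite le_eqVlt => /orP[//|sl1].
  pose b := Num.min 1 (s + e / 2).
  have sb : s < b by rewrite lt_min sl1 ltrDl divr_gt0.
  suff : S b by move=> /(ub_le_sup hsS.2); rewrite leNgt sb.
  have Csb : C (q s b).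
    by apply: er; rewrite sb /= gt_min ltrD2l ltr_pdivrMr// mulr_natr mulr2n ltrDl e0 orbT.
  split; first by rewrite (ltW (le_lt_trans s0 sb))//= ge_min lexx.
  right; case: Ss => _ [s0E|Cs]; first by rewrite -s0E.
  have [s0E|s0N] := eqVneq s 0; first by rewrite -s0E.
  by apply: q_cvx Cs Csb => //; rewrite lt_neqAle eq_sym s0N.
case: Ss => _; rewrite s1 => -[/eqP|]; first by rewrite oner_eq0.
by rewrite /q subr0 invr1 scale1r.
Qed.

Lemma cvg_dnbhs_scale (c : R) : c != 0 -> (h * c) @[h --> (0:R)^'] --> (0:R)^'.
Proof.
move=> c0 A /= /nbhs_ballP[e /= e0 He].
apply/nbhs_ballP; exists (e / `|c|) => /=; first by rewrite divr_gt0// normr_gt0.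
move=> h; rewrite /ball /= !sub0r !normrN => hc h0; apply: He.
  by rewrite /ball /= sub0r normrN normrM -ltr_pdivlMr// normr_gt0.
by rewrite /= mulf_eq0 negb_or h0.
Qed.

(** Base point and direction may both move with the increment: along the segment from
    a t to a t + e t *: b t the derivatives stay close to df (y, w) by joint
    continuity, and the mean value inclusion transfers this to the quotient. *)
Lemma strict_diff (E F : tvsType R) (U : set E) (f : E -> F) (df : E * E -> F)
    (y w : E) T (G : set_system T) {FG : Filter G} (a : T -> E) (b : T -> E)
    (e : T -> R) :
  open U -> U y ->
  (forall x v, U x -> is_ddir f x v (df (x, v))) ->
  {for (y, w), continuous df} ->
  a @ G --> y -> b @ G --> w -> e @ G --> 0 ->
  (\forall t \near G, e t != 0) ->
  ((e t)^-1 *: (f (a t + e t *: b t) - f (a t))) @[t --> G] --> df (y, w).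
Proof.
move=> Uo Uy ddf dfc ay bw e0 en0 N /open_cvx_nbhs[C [Co Cc Cd CN]].
rewrite /= !near_simpl.
have : \forall p \near (y, w), U p.1 /\ C (df p).
  apply: filterI; last by apply: dfc; exact: open_nbhs_nbhs.
  exact: (@cvg_fst E E (nbhs y) (nbhs w) _ U (open_nbhs_nbhs (conj Uo Uy))).
move=> near_p.
have : \forall p \near ((y, w), 0 : R^o),
    (U (p.1.1 + p.2 *: p.1.2) /\ C (df (p.1.1 + p.2 *: p.1.2, p.1.2))).
  have c : (fun p : (E * E) * R^o => (p.1.1 + p.2 *: p.1.2, p.1.2)) @
      nbhs ((y, w), 0 : R^o) --> (y, w).
    apply: cvg_pair; last by apply: (cvg_comp fst snd); [exact: cvg_fst|exact: cvg_snd].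
    apply: (@cvg_addZ0 _ _ _ _ _ _ _ _ _ w).
    + by apply: (cvg_comp fst fst); exact: cvg_fst.
    + exact: cvg_snd.
    + by apply: (cvg_comp fst snd); [exact: cvg_fst|exact: cvg_snd].
  exact: (c _ near_p).
case=> -[A1 A2] /= [A1n /nbhs_ballP[r /= r0 rA2]] HA.
have abn : \forall t \near G, A1 (a t, b t).
  exact: (cvg_pair ay bw A1n).
have er : \forall t \near G, `|e t| < r.
  have b0 : nbhs (0 : R) (ball (0 : R) r) by exact: nbhsx_ballx.
  have : G (e @^-1` ball (0 : R) r) := e0 _ b0.
  apply: filterS => t.
  by rewrite /ball /= sub0r normrN.
apply: filter_app (filterI en0 (filterI abn er)); near=> t => -[et0 [abt ert]].
apply: CN.
have key s : 0 <= s <= 1 ->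
    U (a t + (s * e t) *: b t) /\ C (df (a t + (s * e t) *: b t, b t)).
  move=> /andP[s0 s1].
  apply: (HA ((a t, b t), s * e t)); split=> //=.
  apply: rA2; rewrite /ball /= sub0r normrN normrM ger0_norm//.
  by apply: le_lt_trans ert; rewrite ler_piMl.
have := @mean_value F (fun s => (e t)^-1 *: f (a t + (s * e t) *: b t)) C Co Cc.
rewrite mul1r mul0r scale0r addr0 -scalerBr; apply => s s01.
have [Us Cs] := key s s01.
exists (df (a t + (s * e t) *: b t, b t)) => //.
have /(cvg_comp _ _ (@cvg_dnbhs_scale (e t) et0)) := ddf _ (b t) Us.
apply: cvg_trans; apply: near_eq_cvg; near=> h => /=.
rewrite /diff_quotient -scalerBr scalerA invfM; congr (_ *: (f _ - _)).
by rewrite mulrDl scalerDl addrA.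
Unshelve. all: by end_near. Qed.

Lemma is_ddir_unique (E F : tvsType R) (f : E -> F) x v (l l' : F) :
  hausdorff_space F -> is_ddir f x v l -> is_ddir f x v l' -> l = l'.
Proof. by move=> Fh; apply: cvg_unique. Qed.

Lemma ddirE (E F : tvsType R) (f : E -> F) x v (l : F) :
  hausdorff_space F -> is_ddir f x v l -> ddir f x v = l.
Proof.
move=> Fh fl; apply: (is_ddir_unique Fh _ fl).
exact: (xgetPex 0 (ex_intro _ l fl)).
Qed.

Lemma is_ddirD (E F : tvsType R) (f g : E -> F) x v l m :
  is_ddir f x v l -> is_ddir g x v m -> is_ddir (fun x => f x + g x) x v (l + m).
Proof.
move=> fl gm; apply: cvg_trans (cvg_addv fl gm); apply: near_eq_cvg.
by near=> h; rewrite /diff_quotient -scalerDr opprD addrACA.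
Unshelve. all: by end_near. Qed.

Lemma is_ddirZ (E F : tvsType R) (f : E -> F) x v l (c : R) :
  is_ddir f x v l -> is_ddir f x (c *: v) (c *: l).
Proof.
have [->|c0] := eqVneq c 0.
  move=> _; rewrite !scale0r /is_ddir.
  under eq_fun do rewrite /diff_quotient scaler0 addr0 subrr scaler0.
  exact: cvg_cst.
move=> /(cvg_comp _ _ (@cvg_dnbhs_scale c c0)) /(cvg_scalev (@cvg_cst _ c _ _ _)).
apply: cvg_trans; apply: near_eq_cvg; near=> h => /=.
rewrite /diff_quotient (scalerA h c v) [LHS]scalerA invfM mulrCA divff//.
by rewrite mulr1.
Unshelve. all: by end_near. Qed.

Lemma is_ddir_near (E F : tvsType R) (f g : E -> F) x v l :
  (\forall y \near x, f y = g y) -> is_ddir f x v l -> is_ddir g x v l.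
Proof.
move=> fg fl; apply: cvg_trans fl; apply: near_eq_cvg.
have fgx := nbhs_singleton fg.
have c : (x + h *: v) @[h --> (0:R)^'] --> x.
  by apply: (@cvg_addZ0 _ _ _ _ _ _ _ _ _ v);
    [exact: cvg_cst|exact: nbhs_dnbhs|exact: cvg_cst].
have := c _ fg; rewrite /= !near_simpl.
by apply: filterS => h; rewrite /diff_quotient /= fgx => ->.
Qed.

(** The direction in which f is differentiated is the difference quotient of g, which
    moves with the increment; hence the use of [strict_diff]. *)
Lemma is_ddir_comp (D E F : tvsType R) (U : set E) (f : E -> F) (df : E * E -> F)
    (g : D -> E) x v l :
  open U -> U (g x) ->
  (forall x v, U x -> is_ddir f x v (df (x, v))) ->
  {for (g x, l), continuous df} ->
  is_ddir g x v l -> is_ddir (f \o g) x v (df (g x, l)).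
Proof.
move=> Uo Ugx ddf dfc gl.
have h0 : h @[h --> (0:R)^'] --> (0:R) by exact: nbhs_dnbhs.
have hn0 : \forall h \near (0:R)^', h != 0 by exact: nbhs_dnbhs_neq.
have /(_ _ _) H := strict_diff Uo Ugx ddf dfc (@cvg_cst _ (g x) _ _ _) gl h0 hn0.
rewrite /is_ddir; apply: cvg_trans H; apply: near_eq_cvg; apply: filterS hn0 => h hn0.
rewrite /diff_quotient scalerA divff// scale1r.
by rewrite (addrC (g x)) subrK.
Qed.

(** Additivity in the direction also needs [strict_diff]: after the step along v, the
    step along w starts from a moving base point. *)
Lemma is_ddir_add (E F : tvsType R) (U : set E) (f : E -> F) (df : E * E -> F)
    (x v w : E) :
  hausdorff_space F -> open U -> U x ->
  (forall x v, U x -> is_ddir f x v (df (x, v))) ->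
  {for (x, w), continuous df} ->
  df (x, v + w) = df (x, v) + df (x, w).
Proof.
move=> Fh Uo Ux ddf dfc; apply: (is_ddir_unique Fh (ddf _ _ Ux)).
have h0 : h @[h --> (0:R)^'] --> (0:R) by exact: nbhs_dnbhs.
have hn0 : \forall h \near (0:R)^', h != 0 by exact: nbhs_dnbhs_neq.
have c : (x + h *: v) @[h --> (0:R)^'] --> x.
  by apply: (@cvg_addZ0 _ _ _ _ _ _ _ _ _ v);
    [exact: cvg_cst|exact: nbhs_dnbhs|exact: cvg_cst].
have /(_ _ _) H := strict_diff Uo Ux ddf dfc c (@cvg_cst _ w _ _ _) h0 hn0.
rewrite /is_ddir; apply: cvg_trans (cvg_addv (ddf x v Ux) H); apply: near_eq_cvg.
near=> h; rewrite /diff_quotient -scalerDr; congr (_ *: _).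
by rewrite addrC addrA subrK scalerDr addrA.
Unshelve. all: by end_near. Qed.

End MeanValue.

(** * Maps of class C^k in tangent form *)

Section Ck.
Context {R : realType}.

(** C^k maps in tangent form: f is C^(k+1) when it is continuous and its
    differential (x, v) |-> df(x).v is C^k on U x E. In this form composition is
    handled by a plain induction, the differential of f o g at (x, v) being
    df o (g x, dg(x).v). *)
Fixpoint Ck (n : nat) (E F : tvsType R) (U : set E) (f : E -> F) {struct n} : Prop :=
  (forall x, U x -> {for x, continuous f}) /\
  match n with
  | 0 => True
  | m.+1 => exists df : E * E -> F,
      (forall x v, U x -> is_ddir f x v (df (x, v))) /\
      Ck m (U `*` setT) df
  end.

Lemma Ck_continuous n (E F : tvsType R) (U : set E) (f : E -> F) x :
  Ck n U f -> U x -> {for x, continuous f}.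
Proof. by case: n => [|n] [fc _]; exact: fc. Qed.

Lemma CkW n (E F : tvsType R) (U : set E) (f : E -> F) : Ck n.+1 U f -> Ck n U f.
Proof.
elim: n E F U f => [|n IH] E F U f; first by case.
by move=> [fc [df [ddf dfC]]]; split => //; exists df; split => //; exact: IH.
Qed.

Lemma Ck_sub n (E F : tvsType R) (U V : set E) (f : E -> F) :
  V `<=` U -> Ck n U f -> Ck n V f.
Proof.
elim: n E F U V f => [|n IH] E F U V f VU [fc fd].
  by split=> // x /VU; exact: fc.
split=> [x /VU|]; first exact: fc.
case: fd => df [ddf dfC]; exists df; split=> [x v /VU|]; first exact: ddf.
by apply: IH dfC => -[x v] [/= /VU].
Qed.

Lemma Ck_eq n (E F : tvsType R) (U : set E) (f g : E -> F) :
  open U -> (forall x, U x -> f x = g x) -> Ck n U f -> Ck n U g.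
Proof.
move=> Uo fg.
have near_fg x : U x -> \forall y \near x, f y = g y.
  by move=> Ux; apply: filterS (open_nbhs_nbhs (conj Uo Ux)).
have gc : (forall x, U x -> {for x, continuous f}) ->
    forall x, U x -> {for x, continuous g}.
  move=> fc x Ux; have := fc x Ux; rewrite /prop_for /continuous_at -fg//.
  by apply: cvg_trans; apply: near_eq_cvg; exact: near_fg.
case: n => [|n] [fc fd]; split=> //; [exact: gc|exact: gc|].
case: fd => df [ddf dfC]; exists df; split=> // x v Ux.
by apply: is_ddir_near (ddf x v Ux); exact: near_fg.
Qed.

Lemma Ck_cst n (E F : tvsType R) (U : set E) (c : F) : Ck n U (fun=> c : F).
Proof.
elim: n E U F c => [|n IH] E U F c.
  by split=> // x _; exact: cvg_cst.
split=> [x _|]; first exact: cvg_cst.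
exists (fun=> 0); split=> [x v _|]; last exact: IH.
rewrite /is_ddir; under eq_fun do rewrite /diff_quotient subrr scaler0.
exact: cvg_cst.
Qed.

Lemma Ck_linear n (E F : tvsType R) (U : set E) (f : E -> F) :
  (forall a x y, f (a *: x + y) = a *: f x + f y) -> continuous f -> Ck n U f.
Proof.
elim: n E U f => [|n IH] E U f fl fc; first by split=> // x _; exact: fc.
split=> [x _|]; first exact: fc.
exists (f \o snd); split=> [x v _|].
  rewrite /is_ddir /=; apply: cvg_near_cst.
  have : \forall h \near (0:R)^', h != 0 by exact: nbhs_dnbhs_neq.
  apply: filterS => h h0.
  by rewrite /diff_quotient (addrC x) fl addrK scalerA mulVf// scale1r.
apply: IH => [a p q|x] /=; first by rewrite fl.
by apply: continuous_comp; [exact: cvg_snd|exact: fc].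
Qed.

Lemma Ck_id n (E : tvsType R) (U : set E) : Ck n U (@idfun E).
Proof. by apply: Ck_linear => // x; exact: cvg_id. Qed.

Lemma Ck_fst n (E F : tvsType R) (U : set (E * F)) : Ck n U (@fst E F).
Proof. by apply: Ck_linear => // x; exact: cvg_fst. Qed.

Lemma Ck_snd n (E F : tvsType R) (U : set (E * F)) : Ck n U (@snd E F).
Proof. by apply: Ck_linear => // x; exact: cvg_snd. Qed.

Lemma Ck_pair n (D E F : tvsType R) (U : set D) (f : D -> E) (g : D -> F) :
  Ck n U f -> Ck n U g -> Ck n U (fun x => (f x, g x)).
Proof.
elim: n D E F U f g => [|n IH] D E F U f g [fc fd] [gc gd]; split=> //.
- by move=> x Ux; apply: cvg_pair; [exact: fc|exact: gc].
- by move=> x Ux; apply: cvg_pair; [exact: fc|exact: gc].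
case: fd gd => df [ddf dfC] [dg [ddg dgC]].
exists (fun p => (df p, dg p)); split=> [x v Ux|]; last exact: IH.
exact: cvg_pair (ddf x v Ux) (ddg x v Ux).
Qed.

Lemma open_prod (E F : topologicalType) (U : set E) (V : set F) :
  open U -> open V -> open (U `*` V).
Proof.
move=> Uo Vo; rewrite openE => -[x y] [/= Ux Vy].
by exists (U, V) => //; split; exact: open_nbhs_nbhs.
Qed.

Lemma open_prodT (E F : topologicalType) (U : set E) :
  open U -> open (U `*` [set: F]).
Proof. by move=> Uo; apply: open_prod => //; exact: openT. Qed.

Lemma Ck_comp n (D E F : tvsType R) (U : set E) (V : set D) (f : E -> F) (g : D -> E) :
  open U -> open V -> (forall x, V x -> U (g x)) ->
  Ck n U f -> Ck n V g -> Ck n V (f \o g).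
Proof.
elim: n D E F U V f g => [|n IH] D E F U V f g Uo Vo VU fC gC; split=> //.
- by move=> x Vx; apply: continuous_comp;
    [exact: (Ck_continuous gC)|exact: (Ck_continuous fC (VU _ Vx))].
- by move=> x Vx; apply: continuous_comp;
    [exact: (Ck_continuous gC)|exact: (Ck_continuous fC (VU _ Vx))].
have [_ [df [ddf dfC]]] := fC; have [_ [dg [ddg dgC]]] := gC.
exists (df \o (fun p => (g p.1, dg p))); split=> [x v Vx|].
  apply: (is_ddir_comp Uo) (ddg x v Vx) => //; first exact: VU.
  by apply: (Ck_continuous dfC); split=> //=; exact: VU.
apply: (IH _ _ _ (U `*` setT)) => //; [exact: open_prodT|exact: open_prodT| |].
  by move=> [x v] [/= Vx _]; split=> //; exact: VU.
apply: Ck_pair => //; apply: (IH _ _ _ V _ g fst) => //; first exact: open_prodT.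
- by move=> [x v] [].
- exact: CkW.
- exact: Ck_fst.
Qed.

Lemma Ck_add n (E F : tvsType R) (U : set E) (f g : E -> F) :
  open U -> Ck n U f -> Ck n U g -> Ck n U (fun x => f x + g x).
Proof.
elim: n E F U f g => [|n IH] E F U f g Uo [fc fd] [gc gd]; split=> //.
- by move=> x Ux; apply: cvg_addv; [exact: fc|exact: gc].
- by move=> x Ux; apply: cvg_addv; [exact: fc|exact: gc].
case: fd gd => df [ddf dfC] [dg [ddg dgC]].
exists (fun p => df p + dg p); split=> [x v Ux|].
  by apply: is_ddirD; [exact: ddf|exact: ddg].
by apply: IH => //; exact: open_prodT.
Qed.

Lemma Ck_sum n (E F : tvsType R) (U : set E) (I : Type) (r : seq I) (f : I -> E -> F) :
  open U -> (forall i, Ck n U (f i)) -> Ck n U (fun x => \sum_(i <- r) f i x).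
Proof.
move=> Uo fC; elim: r => [|i r IH].
  by under eq_fun do rewrite big_nil; exact: Ck_cst.
by under eq_fun do rewrite big_cons; exact: Ck_add.
Qed.

Lemma Ck_scale n (E F : tvsType R) (U : set E) (k : E -> R^o) (f : E -> F) :
  open U -> Ck n U k -> Ck n U f -> Ck n U (fun x => k x *: f x).
Proof.
elim: n E F U k f => [|n IH] E F U k f Uo kC fC; split=> //.
- by move=> x Ux; apply: cvg_scalev;
    [exact: (Ck_continuous kC)|exact: (Ck_continuous fC)].
- by move=> x Ux; apply: cvg_scalev;
    [exact: (Ck_continuous kC)|exact: (Ck_continuous fC)].
have [kc [dk [ddk dkC]]] := kC; have [fc [df [ddf dfC]]] := fC.
exists (fun p => dk p *: f p.1 + k p.1 *: df p); split=> [x v Ux|].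
  have fx : f (x + h *: v) @[h --> (0:R)^'] --> f x.
    apply: (cvg_comp (fun h : R => x + h *: v) f); last exact: fc.
    apply: (@cvg_addZ0 _ _ _ _ _ id (fun=> x) (fun=> v) x v).
    + exact: cvg_cst.
    + exact: nbhs_dnbhs.
    + exact: cvg_cst.
  have H1 : (diff_quotient k x v h *: f (x + h *: v)) @[h --> (0:R)^'] -->
      dk (x, v) *: f x by apply: cvg_scalev fx; exact: ddk.
  have H2 : (k x *: diff_quotient f x v h) @[h --> (0:R)^'] -->
      k x *: df (x, v) by apply: cvg_scalev; [exact: cvg_cst|exact: ddf].
  rewrite /is_ddir; apply: cvg_trans (cvg_addv H1 H2); apply: near_eq_cvg; near=> h.
  rewrite /diff_quotient (scalerA (k x)) mulrC -(scalerA h^-1) /= -scalerA.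
  rewrite -scalerDr; congr (_ *: _).
  by rewrite scalerBl scalerBr addrA subrK.
have UTo : open (U `*` [set: E]) by exact: open_prodT.
have c1 (G : tvsType R) (g : E -> G) : Ck n.+1 U g -> Ck n (U `*` setT) (g \o @fst E E).
  move=> /CkW gC; apply: (Ck_comp Uo UTo) => //; last exact: Ck_fst.
  by move=> [x v] [].
apply: Ck_add => //; apply: IH => //; [exact: (c1 _ f)|exact: (c1 _ k)].
Unshelve. all: by end_near. Qed.

End Ck.

(** * From the tangent form to iterated differentials *)

Section CkSmooth.
Context {R : realType}.

(** Nested binary products, which are locally convex spaces by instance inference;
    they stand for the power 'I_k -> E, with [pack] splitting off the last vector as
    [diffn] does. The factor E for k = 0 is a dummy. *)
Fixpoint npow (E : tvsType R) (k : nat) : tvsType R :=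
  match k with 0 => E | k.+1 => (npow E k * E)%type end.

Fixpoint pack (E : tvsType R) (k : nat) : ('I_k -> E) -> npow E k :=
  match k return ('I_k -> E) -> npow E k with
  | 0 => fun=> 0
  | k.+1 => fun v => (pack (forget_last v), v ord_max)
  end.

Lemma cvg_pack (E : tvsType R) T (G : set_system T) {FG : Filter G} k
    (u : T -> 'I_k -> E) (v : 'I_k -> E) :
  (forall i, u t i @[t --> G] --> v i) -> pack (u t) @[t --> G] --> pack v.
Proof.
elim: k u v => [|k IH] u v uv; first exact: cvg_cst.
apply: cvg_pair; last exact: uv.
by apply: (IH (fun t => forget_last (u t))) => i; exact: uv.
Qed.

Lemma cvg_prod_topology I (X : topologicalType) T (G : set_system T) {FG : Filter G}
    (u : T -> prod_topology (fun _ : I => X)) (v : prod_topology (fun _ : I => X)) :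
  (forall i, u t i @[t --> G] --> v i) -> u @ G --> v.
Proof.
move=> uv; apply/cvg_sup => i A; rewrite nbhsE /= => -[B [[C oC <-] Cv] BA].
rewrite /= !near_simpl.
have : \forall t \near G, C (u t i) by apply: uv; exact: open_nbhs_nbhs.
by apply: filterS => t Ct; exact: BA.
Qed.

Lemma pair_addZ0 (E F : lmodType R) (x w : E) (q : F) (h : R) :
  (x, q) + h *: (w, 0) = (x + h *: w, q).
Proof. by apply: injective_projections => //=; rewrite scaler0 addr0. Qed.

(** The differential of order k + 1 is a partial differential of the one of order k:
    d^(k+1)f(x).(v, w) = dPhi((x, v), (w, 0)). *)
Lemma Ck_diffn (E F : tvsType R) (U : set E) (f : E -> F) m k :
  hausdorff_space F -> open U -> Ck (m + k) U f ->
  exists Phi : E * npow E k -> F, Ck m (U `*` setT) Phi /\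
    forall x (v : 'I_k -> E), U x -> diffn f x v = Phi (x, pack v).
Proof.
move=> Fh Uo; elim: k m => [|k IH] m fC.
  exists (f \o fst); split=> //; rewrite addn0 in fC.
  apply: (Ck_comp Uo (open_prodT Uo) _ fC); last exact: Ck_fst.
  by move=> [x v] [].
have [Phi [[PhiC [dPhi [ddPhi dPhiC]]] PhiE]] := IH m.+1 ltac:(by rewrite addSnnS).
exists (dPhi \o (fun p : E * (npow E k * E) => ((p.1, p.2.1), (p.2.2, 0)))).
split.
  apply: (Ck_comp _ _ _ dPhiC).
  - exact/open_prodT/open_prodT.
  - exact: open_prodT.
  - by move=> [x v] [/= Ux _]; split.
  have c1 : Ck m (U `*` setT) (@snd E (npow E k * E)%type) by exact: Ck_snd.
  have T2 : open (U `*` [set: npow E k * E]) by exact: open_prodT.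
  apply: Ck_pair; apply: Ck_pair.
  - exact: Ck_fst.
  - by apply: (@Ck_comp _ m _ _ _ setT _ fst snd) => //; [exact: openT|exact: Ck_fst].
  - by apply: (@Ck_comp _ m _ _ _ setT _ snd snd) => //; [exact: openT|exact: Ck_snd].
  - exact: Ck_cst.
move=> x v Ux /=; apply: ddirE => //.
have := ddPhi (x, pack (forget_last v)) (v ord_max, 0) (conj Ux I).
move=> H; apply: (@is_ddir_near _ _ _ (fun y => Phi (y, pack (forget_last v)))).
  by apply: filterS (open_nbhs_nbhs (conj Uo Ux)) => y Uy; rewrite PhiE.
rewrite /is_ddir; apply: cvg_trans H; apply: near_eq_cvg; near=> h.
by rewrite /diff_quotient pair_addZ0.
Unshelve. all: by end_near. Qed.

Lemma Ck_is_ddir_diffn (E F : tvsType R) (U : set E) (f : E -> F) k x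
    (v : 'I_k.+1 -> E) :
  hausdorff_space F -> open U -> Ck k.+1 U f -> U x ->
  exists l, is_ddir (fun y => diffn f y (forget_last v)) x (v ord_max) l.
Proof.
move=> Fh Uo fC Ux.
have [Phi [[PhiC [dPhi [ddPhi _]]] PhiE]] := @Ck_diffn E F U f 1 k Fh Uo fC.
exists (dPhi ((x, pack (forget_last v)), (v ord_max, 0))).
apply: (@is_ddir_near _ _ _ (fun y => Phi (y, pack (forget_last v)))).
  by apply: filterS (open_nbhs_nbhs (conj Uo Ux)) => y Uy; rewrite PhiE.
have H := ddPhi (x, pack (forget_last v)) (v ord_max, 0) (conj Ux I).
rewrite /is_ddir; apply: cvg_trans H; apply: near_eq_cvg; near=> h.
by rewrite /diff_quotient pair_addZ0.
Unshelve. all: by end_near. Qed.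

Lemma Ck_smooth_on (E F : tvsType R) (U : set E) (f : E -> F) :
  hausdorff_space F -> open U -> (forall n, Ck n U f) -> smooth_on U f.
Proof.
move=> Fh Uo fC n; split.
  rewrite continuous_open_subspace// => x; rewrite inE.
  exact: (Ck_continuous (fC 0%N)).
move=> k kn; split=> [x v Ux|]; first exact: Ck_is_ddir_diffn (fC _) Ux.
rewrite continuous_open_subspace; last exact: open_prodT.
move=> [x v] /[!inE] -[/= Ux _].
have [Phi [PhiC PhiE]] := @Ck_diffn E F U f 0 k.+1 Fh Uo (fC _).
rewrite /continuous_at [X in _ --> X](PhiE x v Ux).
have := Ck_continuous PhiC (conj Ux I : (U `*` setT) (x, pack v)).
have c : (fun p : E * prod_topology (fun=> E) => (p.1, pack p.2 : npow E k.+1)) @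
    nbhs (x, v : prod_topology (fun=> E)) --> (x, pack v : npow E k.+1).
  apply: (@cvg_pair _ _ _ _ (nbhs x) (nbhs (pack v : npow E k.+1))).
    exact: cvg_fst.
  apply: (@cvg_pack E _ _ _ k.+1 (fun p : E * prod_topology (fun=> E) => p.2)) => i.
  apply: (cvg_comp snd (fun w : prod_topology (fun=> E) => w i)).
    exact: cvg_snd.
  exact: (@proj_continuous _ (fun=> E) i v).
move=> /(cvg_comp _ _ c); apply: cvg_trans; apply: near_eq_cvg.
have : \forall p \near nbhs (x, v : prod_topology (fun=> E)), U p.1.
  apply: (@cvg_fst _ _ (nbhs x) (nbhs (v : prod_topology (fun=> E)))).
  exact: open_nbhs_nbhs.
by apply: filterS => -[y w] Uy; rewrite [RHS](PhiE y w Uy).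
Qed.

End CkSmooth.

(** * From iterated differentials to the tangent form *)

Section SmoothComposition.
Context {R : realType} {E F : tvsType R}.

Definition upd k (v : 'I_k -> E) (i : 'I_k) (e : E) : 'I_k -> E :=
  fun j => if j == i then e else v j.

Definition snoc k (u : 'I_k -> E) (w : E) : 'I_k.+1 -> E :=
  fun j => oapp u w (insub (val j)).

Lemma forget_last_snoc k (u : 'I_k -> E) w : forget_last (snoc u w) = u.
Proof. by apply/funext => j; rewrite /forget_last /snoc /= valK. Qed.

Lemma snoc_max k (u : 'I_k -> E) w : snoc u w ord_max = w.
Proof. by rewrite /snoc insubN//= ltnn. Qed.

Lemma snoc_forget_last k (v : 'I_k.+1 -> E) :
  snoc (forget_last v) (v ord_max) = v.
Proof.
apply/funext => j; rewrite /snoc; case: insubP => [i _ ij|] /=.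
  by rewrite /forget_last; congr v; apply: val_inj.
rewrite -leqNgt => kj; congr v; apply: val_inj => /=.
by apply/eqP; rewrite eqn_leq kj -ltnS ltn_ord.
Qed.

Variables (U : set E) (f : E -> F).
Hypotheses (Fh : hausdorff_space F) (Uo : open U) (fS : smooth_on U f).

Lemma is_ddir_diffn k x (u : 'I_k -> E) w : U x ->
  is_ddir (fun y => diffn f y u) x w (diffn f x (snoc u w)).
Proof.
move=> Ux; have [_ /(_ k (ltnSn k))[ex _]] := fS k.+1.
have [l] := ex x (snoc u w) Ux.
rewrite forget_last_snoc snoc_max => fl.
by rewrite /= forget_last_snoc snoc_max (ddirE Fh fl).
Qed.

Lemma cvg_diffn k T (G : set_system T) {FG : Filter G} (a : T -> E)
    (b : T -> 'I_k -> E) x (v : 'I_k -> E) : U x ->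
  a @ G --> x -> (forall i, b t i @[t --> G] --> v i) ->
  diffn f (a t) (b t) @[t --> G] --> diffn f x v.
Proof.
case: k b v => [|k] b v Ux ax bv.
  apply: (cvg_comp a f ax); have [+ _] := fS 0%N.
  by rewrite continuous_open_subspace// => /(_ x); apply; rewrite inE.
have [_ /(_ k (ltnSn k))[_ +]] := fS k.+1.
rewrite continuous_open_subspace; last exact: open_prodT.
move=> /(_ (x, v)); rewrite inE => /(_ (conj Ux I)).
apply: (cvg_comp (fun t => (a t, b t : prod_topology (fun=> E)))).
apply: (@cvg_pair _ _ _ _ (nbhs x) (nbhs (v : prod_topology (fun=> E)))) => //.
exact: cvg_prod_topology.
Qed.

(** Each iterated differential is linear in each of its arguments: in the last one
    because it is the derivative in that direction, in the others as a limit. *)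
Lemma diffn_linear k x (v : 'I_k -> E) i (c : R) (a b : E) : U x ->
  diffn f x (upd v i (c *: a + b)) =
  c *: diffn f x (upd v i a) + diffn f x (upd v i b).
Proof.
elim: k x v i => [|k IH] x v i Ux; first by case: i.
have [->|im] := eqVneq i ord_max.
  have updE e : upd v ord_max e = snoc (forget_last v) e.
    rewrite -[LHS]snoc_forget_last /upd eqxx; congr snoc.
    apply/funext => j; rewrite /forget_last ifF//.
    by apply/negbTE; rewrite -val_eqE /= ltn_eqF.
  rewrite !updE.
  have ddf y w := @is_ddir_diffn _ y (forget_last v) w.
  have H := @is_ddir_add R E F U (fun y => diffn f y (forget_last v))
    (fun p => diffn f p.1 (snoc (forget_last v) p.2)) x (c *: a) b Fh Uo Ux ddf.
  rewrite H; last first.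
    apply: cvg_diffn => // [|j]; first exact: cvg_fst.
    by rewrite /snoc /=; case: insub => [j'|] /=; [exact: cvg_cst|exact: cvg_snd].
  congr (_ + _); apply: (is_ddir_unique Fh (ddf _ _ Ux)).
  exact: is_ddirZ (ddf _ _ Ux).
have ik : (i < k)%N.
  by rewrite ltn_neqAle -ltnS ltn_ord andbT; apply: contra im => /eqP ik; apply/eqP/val_inj.
pose j := Ordinal ik.
have updE e : upd v i e = snoc (upd (forget_last v) j e) (v ord_max).
  have e1 : forget_last (upd v i e) = upd (forget_last v) j e.
    by apply/funext => j'; rewrite /forget_last /upd -!val_eqE.
  have e2 : upd v i e ord_max = v ord_max by rewrite /upd eq_sym (negbTE im).
  by rewrite -[LHS]snoc_forget_last e1 e2.
rewrite !updE.
apply: (is_ddir_unique Fh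
  (@is_ddir_diffn _ x (upd (forget_last v) j (c *: a + b)) (v ord_max) Ux)).
apply: (@is_ddir_near _ _ _ (fun y => c *: diffn f y (upd (forget_last v) j a)
    + diffn f y (upd (forget_last v) j b))).
  by apply: filterS (open_nbhs_nbhs (conj Uo Ux)) => y Uy; rewrite IH.
apply: is_ddirD; last exact: is_ddir_diffn.
have : (c *: diff_quotient (fun y => diffn f y (upd (forget_last v) j a)) x
    (v ord_max) h) @[h --> (0:R)^'] -->
    c *: diffn f x (snoc (upd (forget_last v) j a) (v ord_max)).
  by apply: cvg_scalev; [exact: cvg_cst|exact: is_ddir_diffn].
rewrite /is_ddir; apply: cvg_trans; apply: near_eq_cvg; near=> h.
by rewrite /diff_quotient -scalerBr !scalerA mulrC.
Unshelve. all: by end_near. Qed.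

Lemma is_ddir_cvg (D X : tvsType R) (g : D -> X) x w l :
  is_ddir g x w l -> g (x + h *: w) @[h --> (0:R)^'] --> g x.
Proof.
move=> gl.
have : (g x + h *: diff_quotient g x w h) @[h --> (0:R)^'] --> g x.
  by apply: cvg_addZ0 gl; [exact: cvg_cst|exact: nbhs_dnbhs].
apply: cvg_trans; apply: near_eq_cvg.
have : \forall h \near (0:R)^', h != 0 by exact: nbhs_dnbhs_neq.
apply: filterS => h h0; rewrite /diff_quotient scalerA divff// scale1r.
by rewrite (addrC (g x)) subrK.
Qed.

(** The derivative of a multilinear expression in moving arguments: the base point
    contributes one more differential, and each argument is replaced in turn by its
    derivative. *)
Lemma is_ddir_diffn_comp (D : tvsType R) k (g0 : D -> E) (g : 'I_k -> D -> E)
    x w l0 (l : 'I_k -> E) :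
  U (g0 x) -> is_ddir g0 x w l0 -> (forall i, is_ddir (g i) x w (l i)) ->
  is_ddir (fun y => diffn f (g0 y) (g^~ y)) x w
    (diffn f (g0 x) (snoc (g^~ x) l0)
      + \sum_(i < k) diffn f (g0 x) (upd (g^~ x) i (l i))).
Proof.
move=> Ux g0l gl.
have ddf y u := @is_ddir_diffn _ y (g^~ x) u.
have g0c := is_ddir_cvg g0l.
have Ug0 : \forall h \near (0:R)^', U (g0 (x + h *: w)).
  by apply: g0c; exact: open_nbhs_nbhs.
have hn0 : \forall h \near (0:R)^', h != 0 by exact: nbhs_dnbhs_neq.
have H1 : diff_quotient (fun y => diffn f (g0 y) (g^~ x)) x w h
    @[h --> (0:R)^'] --> diffn f (g0 x) (snoc (g^~ x) l0).
  apply: (is_ddir_comp (df := fun p => diffn f p.1 (snoc (g^~ x) p.2)) Uo Ux ddf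
    _ g0l).
  apply: cvg_diffn => // [|j]; first exact: cvg_fst.
  by rewrite /snoc /=; case: insub => [j'|] /=; [exact: cvg_cst|exact: cvg_snd].
(* the arguments of the differential are moved from x to x + hw one at a time *)
pose vv h (j : nat) := fun i : 'I_k => if (i < j)%N then g i (x + h *: w) else g i x.
have H2 (i : 'I_k) : diffn f (g0 (x + h *: w)) (upd (vv h i) i (diff_quotient (g i) x w h))
    @[h --> (0:R)^'] --> diffn f (g0 x) (upd (g^~ x) i (l i)).
  apply: cvg_diffn => // j; rewrite /upd; case: (j == i); first exact: gl.
  by rewrite /vv; case: (j < i)%N; [exact: (is_ddir_cvg (gl j))|exact: cvg_cst].
have H3 : (\sum_(i < k) diffn f (g0 (x + h *: w))
      (upd (vv h i) i (diff_quotient (g i) x w h))) @[h --> (0:R)^'] -->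
    \sum_(i < k) diffn f (g0 x) (upd (g^~ x) i (l i)).
  by apply: cvg_sumv; exact: H2.
rewrite /is_ddir; apply: cvg_trans (cvg_addv H1 H3); apply: near_eq_cvg.
apply: filterS2 Ug0 hn0 => h Uh h0.
transitivity (h^-1 *: (diffn f (g0 (x + h *: w)) (g^~ x) - diffn f (g0 x) (g^~ x))
  + h^-1 *: \sum_(0 <= j < k) (diffn f (g0 (x + h *: w)) (vv h j.+1)
      - diffn f (g0 (x + h *: w)) (vv h j))).
  congr (_ + _); rewrite scaler_sumr big_mkord; apply: eq_bigr => i _.
  have -> : vv h i.+1 = upd (vv h i) i (g i (x + h *: w)).
    apply/funext => j; rewrite /upd /vv ltnS leq_eqVlt.
    by have [->|ji] := eqVneq j i; rewrite ?eqxx//= val_eqE (negbTE ji).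
  have -> : diffn f (g0 (x + h *: w)) (vv h i) =
      diffn f (g0 (x + h *: w)) (upd (vv h i) i (g i x)).
    congr diffn; by apply/funext => j; rewrite /upd; case: eqP => // ->; rewrite /vv ltnn.
  have -> : diff_quotient (g i) x w h = h^-1 *: g i (x + h *: w) + - h^-1 *: g i x.
    by rewrite /diff_quotient scalerBr scaleNr.
  rewrite diffn_linear//.
  have -> : diffn f (g0 (x + h *: w)) (upd (vv h i) i (- h^-1 *: g i x)) =
      - h^-1 *: diffn f (g0 (x + h *: w)) (upd (vv h i) i (g i x)).
    have z : diffn f (g0 (x + h *: w)) (upd (vv h i) i 0) = 0.
      have := @diffn_linear _ (g0 (x + h *: w)) (vv h i) i 1 0 0 Uh.
      rewrite !scale1r addr0 => /eqP; rewrite eq_sym -subr_eq0 addrK => /eqP.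
      by [].
    by rewrite -[X in upd _ _ X]addr0 diffn_linear// z addr0.
  by rewrite scaleNr scalerBr.
rewrite telescope_sumr// -scalerDr /diff_quotient; congr (_ *: _).
have -> : vv h 0 = g^~ x by apply/funext.
have -> : vv h k = g^~ (x + h *: w) by apply/funext => i; rewrite /vv ltn_ord.
by rewrite addrC addrA subrK.
Qed.

(** The class of these functions is closed under differentiation, which is what
    makes the induction on n work. Letting the vectors be functions of x, instead of
    variables, avoids a topology of locally convex space on 'I_k -> E. *)
Lemma Ck_diffn_comp (D : tvsType R) (O : set D) n k (g0 : D -> E) (g : 'I_k -> D -> E) :
  open O -> (forall x, O x -> U (g0 x)) ->
  Ck n O g0 -> (forall i, Ck n O (g i)) ->
  Ck n O (fun x => diffn f (g0 x) (g^~ x)).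
Proof.
elim: n D O k g0 g => [|n IH] D O k g0 g Oo OU g0C gC; split=> //.
- move=> x Ox; apply: cvg_diffn; first exact: OU.
    exact: (Ck_continuous g0C).
  by move=> i; exact: (Ck_continuous (gC i)).
- move=> x Ox; apply: cvg_diffn; first exact: OU.
    exact: (Ck_continuous g0C).
  by move=> i; exact: (Ck_continuous (gC i)).
have [_ [dg0 [ddg0 dg0C]]] := g0C.
have /choice[dg dgP] : forall i, exists dg : D * D -> E,
    (forall x v, O x -> is_ddir (g i) x v (dg (x, v))) /\ Ck n (O `*` setT) dg.
  by move=> i; have [] := gC i.
have OTo : open (O `*` [set: D]) by exact: open_prodT.
have fstC (h : D -> E) : Ck n.+1 O h -> Ck n (O `*` setT) (h \o @fst D D).
  move=> /CkW hC; apply: (Ck_comp Oo OTo) => //; last exact: Ck_fst.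
  by move=> [x v] [].
exists (fun p => diffn f (g0 p.1) (snoc (fun i => g i p.1) (dg0 p))
      + \sum_(i < k) diffn f (g0 p.1) (upd (fun i => g i p.1) i (dg i p))).
split=> [x v Ox|].
  apply: is_ddir_diffn_comp; [exact: OU|exact: ddg0|].
  by move=> i; apply: (dgP i).1.
have OU' (p : D * D) : (O `*` setT) p -> U (g0 p.1) by move=> [/OU].
apply: Ck_add => //.
  apply: (IH _ _ _ (g0 \o fst) (fun j p => snoc (fun i => g i p.1) (dg0 p) j)) => //.
    exact: fstC.
  by move=> j; rewrite /snoc; case: insub => [i|] //=; exact: fstC.
apply: Ck_sum => // i.
apply: (IH _ _ _ (g0 \o fst) (fun j p => upd (fun i => g i p.1) i (dg i p) j)) => //.
  exact: fstC.
by move=> j; rewrite /upd; case: eqP => [_|_] //; [exact: (dgP i).2|exact: fstC].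
Qed.

Lemma smooth_on_Ck n : Ck n U f.
Proof.
apply: (@Ck_diffn_comp _ _ _ 0 id (fun i _ => 0)) => //.
  exact: Ck_id.
by move=> i; exact: Ck_cst.
Qed.

End SmoothComposition.

(** * Plateau functions on R^d *)

Section FlatFunctions.
Context {R : realType}.

(** The functions t^-n exp(-1/t), extended by 0 to t <= 0. They are treated together
    because the derivative of each is a combination of the next two. *)
Definition flat (n : nat) (t : R) : R :=
  if 0 < t then t^-1 ^+ n * expR (- t^-1) else 0.

Lemma flat_ge0 n t : 0 <= flat n t.
Proof.
by rewrite /flat; case: ifP => // t0; rewrite mulr_ge0 ?expR_ge0// exprn_ge0// invr_ge0 ltW.
Qed.

Lemma flat_le0 n t : t <= 0 -> flat n t = 0.
Proof. by rewrite /flat leNgt => /negbTE ->. Qed.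

(** exp(1/t) >= (1 / ((n + 1) t))^(n + 1), so that [flat n] is O(t) at 0. Since
    flat n t / t = flat n.+1 t, this gives the derivative 0 at 0. *)
Lemma flat_le n t : 0 < t -> flat n t <= n.+1%:R ^+ n.+1 * t.
Proof.
move=> t0; rewrite /flat t0 expRN.
have tn0 : t != 0 by rewrite gt_eqF.
have n0 : n.+1%:R != 0 :> R by rewrite pnatr_eq0.
rewrite ler_pdivrMr ?expR_gt0//.
set e := expR t^-1; set c : R := n.+1%:R.
have le1 : (t^-1 / c) ^+ n.+1 <= e.
  have -> : e = expR (t^-1 / c) ^+ n.+1.
    by rewrite -expRM_natl mulrCA divff// mulr1.
  rewrite lerXn2r// ?nnegrE ?expR_ge0//.
    by rewrite divr_ge0// invr_ge0 ltW.
  by apply: le_trans (expR_ge1Dx _); rewrite lerDr.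
have -> : t^-1 ^+ n = c ^+ n.+1 * t * (t^-1 / c) ^+ n.+1.
  rewrite exprMn (mulrC (t^-1 ^+ _)) mulrACA -exprMn divff// expr1n mul1r.
  by rewrite exprS mulrA divff// mul1r.
by rewrite ler_wpM2l// mulr_ge0 ?exprn_ge0// ltW.
Qed.

Lemma is_ddir_flat_gt0 n (t : R) : 0 < t ->
  is_ddir (flat n : R^o -> R^o) t 1 (flat n.+2 t - n%:R * flat n.+1 t).
Proof.
move=> t0; have tn0 : t != 0 by rewrite gt_eqF.
apply: (@is_ddir_near _ _ _ (fun t : R^o => t^-1 ^+ n * expR (- t^-1) : R^o)).
  have : \forall y \near t, 0 < y by exact: lt_nbhsr.
  by apply: filterS => y; rewrite /flat => ->.
have Dv : is_derive t (1 : R) (fun t : R => t^-1) (- t ^- 2 *: 1).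
  exact: (@is_deriveV R id).
have De : is_derive t (1 : R) (expR \o (fun t : R => - t^-1))
    (expR (- t^-1) * - (- t ^- 2 *: 1)).
  by apply: is_derive1_comp.
have [dv dE] := is_deriveM (is_deriveX n Dv) De.
have -> : flat n.+2 t - n%:R * flat n.+1 t =
  'D_1 ((fun t : R => t^-1) ^+ n * (expR \o (fun t : R => - t^-1))) t.
  rewrite dE /flat t0 /= exprfctE /GRing.scale /= !mulr1.
  rewrite -[- - _]/(- (- t ^- 2)) opprK -exprVn.
  case: n {dv dE} => [|n] /=; rewrite ?mul0r ?mulr0 ?addr0 ?subr0.
    by rewrite expr0 mul1r mulrC.
  by rewrite !exprS; ring.
have : cvg (h^-1 *: ((((fun t : R => t^-1) ^+ n * (expR \o (fun t : R => - t^-1)))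
  \o shift t) (h *: (1 : R)) - ((fun t : R => t^-1) ^+ n * (expR \o (fun t : R => - t^-1))) t)
   @[h --> (0 : R)^']) by exact: dv.
rewrite /is_ddir /diff_quotient /derive.
move=> c; apply: cvg_trans c; apply: near_eq_cvg; near=> h.
by rewrite /= /shift /= /GRing.mul /= exprfctE /= (addrC t).
Unshelve. all: by end_near. Qed.

Lemma is_ddir_flat n (t : R) :
  is_ddir (flat n : R^o -> R^o) t 1 (flat n.+2 t - n%:R * flat n.+1 t).
Proof.
have [t0|t0|<-] := ltgtP 0 t; first exact: is_ddir_flat_gt0.
  rewrite !flat_le0; [|exact: ltW|exact: ltW]; rewrite mulr0 subr0.
  apply: (@is_ddir_near _ _ _ (fun _ : R^o => 0 : R^o)).
    have : \forall y \near t, y < 0 by exact: lt_nbhsl.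
    by apply: filterS => y y0; rewrite flat_le0// ltW.
  rewrite /is_ddir; under eq_fun do rewrite /diff_quotient subrr scaler0.
  exact: cvg_cst.
rewrite !flat_le0// mulr0 subr0 /is_ddir.
pose c : R := n.+2%:R ^+ n.+2.
have c0 : 0 < c by rewrite exprn_gt0.
apply/cvgrPdist_lt => e e0; near=> h.
rewrite /diff_quotient (flat_le0 n (lexx 0)) subr0 sub0r normrN add0r /GRing.scale /= mulr1.
have [h0|h0] := ltP 0 h; last by rewrite flat_le0// mulr0 normr0.
have -> : h^-1 * flat n h = flat n.+1 h by rewrite /flat h0 exprS mulrA.
rewrite ger0_norm ?flat_ge0//; apply: (le_lt_trans (flat_le _ h0)).
rewrite -/c mulrC -ltr_pdivlMr//; near: h.
apply: nbhs_dnbhs; apply: lt_nbhsl.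
by rewrite divr_gt0.
Unshelve. all: by end_near. Qed.

Lemma Ck_flat m n : Ck m [set: R^o] (flat n : R^o -> R^o).
Proof.
elim: m n => [|m IH] n; last first.
  split; first by move=> x _; exact: (Ck_continuous (IH n)).
  exists (fun p : R^o * R^o => p.2 *: (flat n.+2 p.1 - n%:R * flat n.+1 p.1)).
  split=> [x v _|].
    by have := @is_ddirZ _ _ _ _ x 1 _ v (@is_ddir_flat n x); rewrite /GRing.scale /= mulr1.
  have oT : open ([set: R^o] `*` [set: R^o]) by apply: open_prodT; exact: openT.
  have C1 k : Ck m ([set: R^o] `*` [set: R^o]) (fun p => flat k p.1 : R^o).
    apply: (Ck_comp openT oT _ (IH k) (g := fst)) => //; exact: Ck_fst.
  apply: Ck_scale => //; first exact: Ck_snd.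
  apply: Ck_add => //.
  have -> : (fun x : R^o * R^o => - (n%:R * flat n.+1 x.1)) =
      (fun x : R^o * R^o => (- n%:R : R^o) *: (flat n.+1 x.1 : R^o)).
    by apply/funext => x; rewrite -mulNr.
  by apply: Ck_scale => //; exact: Ck_cst.
split=> // x _; apply/continuous_withinNshiftx.
have := is_ddir_cvg (@is_ddir_flat n x).
apply: cvg_trans; apply: near_eq_cvg; near=> h.
by rewrite /= /shift /= /GRing.scale /= mulr1 addrC.
Unshelve. all: by end_near. Qed.

Lemma flat_mono (s t : R) : s <= t -> flat 0 s <= flat 0 t.
Proof.
move=> st; have [s0|s0] := ltP 0 s; last by rewrite (flat_le0 _ s0) flat_ge0.
have t0 : 0 < t by exact: lt_le_trans st.
rewrite /flat s0 t0 !expr0 !mul1r ler_expR lerN2 lef_pV2//.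
Qed.

Lemma flat_gt0 (t : R) : 0 < t -> 0 < flat 0 t.
Proof. by move=> t0; rewrite /flat t0 expr0 mul1r expR_gt0. Qed.

(** A plateau function without division by a variable quantity: with c = flat 0 (r/2)
    and a smooth u >= 0 that vanishes near x and exceeds c away from it,
    flat 0 (c - u) is the constant flat 0 c near x and 0 away from it. *)
Lemma bump_rV d (x : 'rV[R]_d) (r : R) : 0 < r ->
  exists b : 'rV[R]_d -> R^o,
    [/\ forall n, Ck n setT b, forall z, 0 <= b z <= 1,
        forall z : 'rV[R]_d, (forall i, `|z ord0 i - x ord0 i| <= r / 2) -> b z = 1
      & forall z : 'rV[R]_d, (exists i, r <= `|z ord0 i - x ord0 i|) -> b z = 0].
Proof.
move=> r0; have r20 : 0 < r / 2 by rewrite divr_gt0.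
pose c := flat 0 (r / 2); have c0 : 0 < c by exact: flat_gt0.
have fc0 : 0 < flat 0 c by exact: flat_gt0.
pose u (z : 'rV[R]_d) := \sum_(i < d) (flat 0 (z ord0 i - x ord0 i - r / 2)
  + flat 0 (x ord0 i - z ord0 i - r / 2)).
have u0 z : 0 <= u z by apply: sumr_ge0 => i _; rewrite addr_ge0 ?flat_ge0.
exists (fun z => (flat 0 c)^-1 *: (flat 0 (c - u z) : R^o)); split.
- move=> n.
  have aff i (a b : R) :
      Ck n setT (fun z : 'rV[R]_d => a *: (z ord0 i : R^o) + (b : R^o)).
    apply: Ck_add; [exact: openT| |exact: Ck_cst].
    apply: Ck_scale; [exact: openT|exact: Ck_cst|].
    by apply: Ck_linear => [k y z|y]; [rewrite !mxE|exact: coord_continuous].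
  have flat_aff i a b : Ck n setT (fun z : 'rV[R]_d =>
      flat 0 (a *: (z ord0 i : R^o) + (b : R^o)) : R^o).
    by apply: (Ck_comp openT openT _ (Ck_flat n 0) (aff i a b)).
  have uC : Ck n setT (u : 'rV[R]_d -> R^o).
    apply: Ck_sum; [exact: openT|move=> i; apply: Ck_add; first exact: openT].
      have := flat_aff i 1 (- x ord0 i - r / 2).
      by apply: Ck_eq => [|z _]; [exact: openT|rewrite scale1r addrA].
    have := flat_aff i (-1) (x ord0 i - r / 2).
    by apply: Ck_eq => [|z _]; [exact: openT|rewrite scaleN1r addrA (addrC (- _))].
  apply: Ck_scale; [exact: openT|exact: Ck_cst|].
  apply: (Ck_comp (g := fun z => (c - u z : R^o)) openT openT _ (Ck_flat n 0)) => //.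
  apply: Ck_add; [exact: openT|exact: Ck_cst|].
  have : Ck n setT (fun z => (-1 : R^o) *: (u z : R^o)).
    by apply: Ck_scale; [exact: openT|exact: Ck_cst|].
  by apply: Ck_eq => [|z _]; [exact: openT|rewrite scaleN1r].
- move=> z; rewrite /GRing.scale /=; apply/andP; split.
    by rewrite mulr_ge0 ?flat_ge0// invr_ge0 ltW.
  by rewrite mulrC ler_pdivrMr// mul1r; apply: flat_mono; rewrite gerBl.
- move=> z zx; rewrite /u big1 ?subr0 /GRing.scale /= ?mulVf ?gt_eqF// => i _.
  have := zx i; rewrite ler_norml => /andP[h1 h2].
  rewrite !flat_le0 ?addr0 ?subr_le0//.
  by rewrite -lerN2 opprB.
- move=> z [i ri]; rewrite [X in _ *: X]flat_le0 ?scaler0// subr_le0.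
  rewrite /u (bigD1 i)//=; apply: ler_wpDr.
    by apply: sumr_ge0 => j _; rewrite addr_ge0 ?flat_ge0.
  have [zx|zx] := leP 0 (z ord0 i - x ord0 i).
    rewrite ger0_norm// in ri; apply: ler_wpDr; first exact: flat_ge0.
    by apply: flat_mono; rewrite lerBrDr -splitr.
  rewrite ltr0_norm// opprB in ri; apply: ler_wpDl; first exact: flat_ge0.
  by apply: flat_mono; rewrite lerBrDr -splitr.
Qed.

End FlatFunctions.

(** * Smooth germs on a manifold with corners *)

Section Charts.

Lemma within_openP (X Y : topologicalType) (U : set X) (f : X -> Y) x :
  open U -> {within U, continuous f} -> U x -> {for x, continuous f}.
Proof.
by move=> Uo; rewrite continuous_open_subspace// => fc Ux; apply: fc; rewrite inE.
Qed.

Lemma openP_within (X Y : topologicalType) (U : set X) (f : X -> Y) :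
  open U -> (forall x, U x -> {for x, continuous f}) -> {within U, continuous f}.
Proof. by move=> Uo fc; rewrite continuous_open_subspace// => x; rewrite inE; exact: fc. Qed.

Context {X Y : topologicalType} (Y0 : set Y) (c : chart X Y).
Hypothesis cC : is_chart Y0 c.

Lemma chartK x : cdom c x -> cinv c (cmap c x) = x.
Proof. by have [_ _ [/(_ x) + _ _ _] xc] := cC => /(_ xc)[]. Qed.

Lemma chart_cod x : cdom c x -> ccod c (cmap c x).
Proof. by move=> xc; exists x. Qed.

Lemma chart_mod x : cdom c x -> Y0 (cmap c x).
Proof. by move=> /chart_cod; have [_ [O _ ->] _] := cC => -[]. Qed.

Lemma chart_invK z : ccod c z -> cdom c (cinv c z) /\ cmap c (cinv c z) = z.
Proof. by have [_ _ [_ h _ _]] := cC => /h. Qed.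

Lemma chart_open : open (cdom c).
Proof. by have [] := cC. Qed.

Lemma chart_dom_nbhs x : cdom c x -> nbhs x (cdom c).
Proof. by move=> xc; apply: open_nbhs_nbhs; split=> //; exact: chart_open. Qed.

Lemma chart_continuous x : cdom c x -> {for x, continuous (cmap c)}.
Proof. by have [o _ [_ _ cc _]] := cC; exact: within_openP. Qed.

(** Continuity of the inverse of a chart, in the form in which it is used: O is open
    in the whole model space, and only its part in Y0 is concerned. *)
Lemma chart_nbhs x (N : set X) : cdom c x -> nbhs x N ->
  exists O : set Y, [/\ open O, O (cmap c x) &
    forall z, O z -> Y0 z -> ccod c z /\ N (cinv c z)].
Proof.
move=> xc Nx; have [_ [O Oo codE] [_ _ _ ic]] := cC.
have zc := chart_cod xc.
have : cinv c @ within (ccod c) (nbhs (cmap c x)) --> cinv c (cmap c x).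
  by move/subspace_continuousP: ic; apply.
rewrite chartK// => /(_ N Nx).
rewrite /= /within /= !near_simpl nbhsE => -[O' [O'o O'x] O'N].
exists (O `&` O'); split; first exact: openI.
  by split=> //; move: zc; rewrite codE => -[].
move=> z [Oz O'z] Yz; have zC : ccod c z by rewrite codE.
by split=> //; exact: O'N.
Qed.

End Charts.

Section SmoothNear.
Context {R : realType}.

Definition smooth_near (E F : tvsType R) (x : E) (f : E -> F) : Prop :=
  exists O : set E, [/\ open O, O x & forall n, Ck n O f].

Lemma smooth_on_sub (E F : tvsType R) (U V : set E) (f : E -> F) :
  V `<=` U -> smooth_on U f -> smooth_on V f.
Proof.
move=> VU fS n; have [fc fd] := fS n; split; first exact: continuous_subspaceW VU fc.
move=> k kn; have [ex co] := fd k kn; split=> [x v /VU Ux|]; first exact: ex.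
by apply: continuous_subspaceW co => -[x v] [/= /VU].
Qed.

Lemma smooth_on_near (E F : tvsType R) (U : set E) (f : E -> F) x :
  hausdorff_space F -> smooth_on U f -> nbhs x U -> smooth_near x f.
Proof.
move=> Fh fS; rewrite nbhsE => -[V [Vo Vx] VU]; exists V; split=> // n.
by apply: smooth_on_Ck => //; exact: smooth_on_sub fS.
Qed.

Lemma smooth_near_continuous (E F : tvsType R) x (f : E -> F) :
  smooth_near x f -> {for x, continuous f}.
Proof. by move=> [O [Oo Ox /(_ 0%N) fC]]; exact: Ck_continuous fC Ox. Qed.

Lemma smooth_near_comp (D E F : tvsType R) x (g : D -> E) (f : E -> F) :
  smooth_near x g -> smooth_near (g x) f -> smooth_near x (f \o g).
Proof.
move=> [O [Oo Ox gC]] [U [Uo Ux fC]]; exists (O `&` g @^-1` U); split=> //.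
  rewrite openE => y [Oy Uy]; apply: filterI; first exact: open_nbhs_nbhs.
  by apply: (Ck_continuous (gC 0%N) Oy); exact: open_nbhs_nbhs.
move=> n; apply: (Ck_comp Uo) (fC n) _ => //; first last.
  by apply: Ck_sub (gC n) => y [].
  by move=> y [].
rewrite openE => y [Oy Uy]; apply: filterI; first exact: open_nbhs_nbhs.
by apply: (Ck_continuous (gC 0%N) Oy); exact: open_nbhs_nbhs.
Qed.

Lemma smooth_near_pair (D E F : tvsType R) x (f : D -> E) (g : D -> F) :
  smooth_near x f -> smooth_near x g -> smooth_near x (fun y => (f y, g y)).
Proof.
move=> [O [Oo Ox fC]] [U [Uo Ux gC]]; exists (O `&` U); split=> //.
  exact: openI.
move=> n; apply: Ck_pair; first by apply: Ck_sub (fC n) => y [].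
by apply: Ck_sub (gC n) => y [].
Qed.

Lemma smooth_nearT (E F : tvsType R) x (f : E -> F) :
  (forall n, Ck n setT f) -> smooth_near x f.
Proof. by exists setT; split=> //; exact: openT. Qed.

End SmoothNear.

Section SmoothFunctions.
Context {R : realType} {d : nat} {M : topologicalType} (AM : set (chart M 'rV[R]_d)).
Hypothesis M_atlas : smooth_atlas (@corner R d) smooth_sub AM.

Lemma atlasM c : AM c -> is_chart (@corner R d) c.
Proof. by have [h _ _] := M_atlas; exact: h. Qed.

(** On a manifold with corners, smoothness of a germ means that its expression in a
    chart extends smoothly to an open set of R^d. *)
Definition smooth_vec (F : tvsType R) (h : M -> F) (x : M) : Prop :=
  exists c, [/\ AM c, cdom c x & exists2 G : 'rV[R]_d -> F,
    smooth_near (cmap c x) G & \forall y \near x, h y = G (cmap c y)].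

(** The change of charts also extends to an open set of R^d, because the transition
    maps of M are smooth in that sense. *)
Lemma smooth_vec_chart (F : tvsType R) (h : M -> F) x c : smooth_vec h x ->
  AM c -> cdom c x -> exists2 G : 'rV[R]_d -> F,
    smooth_near (cmap c x) G & \forall y \near x, h y = G (cmap c y).
Proof.
move=> [c' [Ac' c'x [G GS Gh]]] Ac cx.
have [_ _ /(_ c c' Ac Ac')] := M_atlas.
move=> /(_ (cmap c x)) []; first by exists x.
move=> U [g [Uo Ux gS gE]].
have gcE y : cdom c y -> cdom c' y -> U (cmap c y) -> g (cmap c y) = cmap c' y.
  move=> cy c'y Uy; rewrite gE//=; last by exists y.
  by rewrite (chartK (atlasM Ac)).
exists (G \o g).
  apply: smooth_near_comp; last by rewrite gcE.
  apply: smooth_on_near gS _; first exact: norm_hausdorff.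
  exact: open_nbhs_nbhs.
have Uc : \forall y \near x, U (cmap c y).
  by apply: (chart_continuous (atlasM Ac) cx); exact: open_nbhs_nbhs.
near=> y; rewrite /= gcE; first by near: y.
- by near: y; exact: (chart_dom_nbhs (atlasM Ac)).
- by near: y; exact: (chart_dom_nbhs (atlasM Ac')).
- by near: y.
Unshelve. all: by end_near. Qed.

Lemma smooth_vec_eq (F : tvsType R) (h h' : M -> F) x :
  (\forall y \near x, h y = h' y) -> smooth_vec h x -> smooth_vec h' x.
Proof.
move=> hh' [c [Ac cx [G GS Gh]]]; exists c; split=> //; exists G => //.
by apply: filterS2 hh' Gh => y <-.
Qed.

Lemma smooth_vec_near (F : tvsType R) (h : M -> F) x :
  smooth_vec h x -> \forall y \near x, smooth_vec h y.
Proof.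
move=> [c [Ac cx [G [O [Oo Ox GC]] Gh]]].
have Oc : \forall y \near x, O (cmap c y).
  by apply: (chart_continuous (atlasM Ac) cx); exact: open_nbhs_nbhs.
have cc := chart_dom_nbhs (atlasM Ac) cx.
have Gh' := near_join Gh.
near=> y; exists c; split=> //; first by near: y.
exists G; last by near: y.
by exists O; split=> //; near: y.
Unshelve. all: by end_near. Qed.

Lemma smooth_vec_continuous (F : tvsType R) (h : M -> F) x :
  smooth_vec h x -> {for x, continuous h}.
Proof.
move=> [c [Ac cx [G /smooth_near_continuous GS Gh]]].
rewrite /prop_for /continuous_at (nbhs_singleton Gh).
have := cvg_comp _ _ (chart_continuous (atlasM Ac) cx) GS.
apply: cvg_trans; apply: near_eq_cvg.
by apply: filterS Gh => y ->.
Qed.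

Lemma smooth_vec_comp (F F' : tvsType R) (h : M -> F) (f : F -> F') x :
  smooth_vec h x -> smooth_near (h x) f -> smooth_vec (f \o h) x.
Proof.
move=> [c [Ac cx [G GS Gh]]] fS; exists c; split=> //; exists (f \o G).
  by apply: smooth_near_comp => //; rewrite -(nbhs_singleton Gh).
by apply: filterS Gh => y /= ->.
Qed.

Lemma smooth_vec_pair (F F' : tvsType R) (h : M -> F) (h' : M -> F') x :
  smooth_vec h x -> smooth_vec h' x -> smooth_vec (fun y => (h y, h' y)) x.
Proof.
move=> [c [Ac cx [G GS Gh]]] /smooth_vec_chart /(_ Ac cx)[G' G'S Gh'].
exists c; split=> //; exists (fun z => (G z, G' z)); first exact: smooth_near_pair.
by apply: filterS2 Gh Gh' => y -> ->.
Qed.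

Lemma smooth_vec_cst (F : tvsType R) (a : F) x : smooth_vec (fun=> a) x.
Proof.
have [_ /(_ x)[c Ac cx] _] := M_atlas; exists c; split=> //.
exists (fun=> a); last exact: nearW.
by apply: smooth_nearT => n; exact: Ck_cst.
Qed.

End SmoothFunctions.

(** * Smooth germs with values in a Lie group *)

Section SmoothGroupValued.
Context {R : realType} {E : tvsType R} {K : preTopologicalGroupType}
  (AK : set (chart K E)) {d : nat} {M : topologicalType} (AM : set (chart M 'rV[R]_d)).
Hypothesis (K_lie : lie_group AK) (M_atlas : smooth_atlas (@corner R d) smooth_sub AM).

Lemma atlasK c : AK c -> is_chart setT c.
Proof. by have [_ _ [h _ _] _ _] := K_lie; exact: h. Qed.

Lemma atlasK_cover k : exists2 c, AK c & cdom c k.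
Proof. by have [_ _ [_ h _] _ _] := K_lie; exact: h. Qed.

Lemma mulK_continuous : continuous (fun x : K * K => (x.1 * x.2)%g).
Proof. by have [_ _ _ [h _] _] := K_lie; exact/continuous_subspace_setT. Qed.

Lemma invK_continuous : continuous (fun x : K => (x^-1)%g).
Proof. by have [_ _ _ _ [h _]] := K_lie; exact/continuous_subspace_setT. Qed.

Lemma cvg_mulK T (G : set_system T) {FG : Filter G} (f g : T -> K) a b :
  f @ G --> a -> g @ G --> b -> (f x * g x)%g @[x --> G] --> (a * b)%g.
Proof.
move=> fa gb.
apply: (cvg_comp (fun x => (f x, g x)) (fun p : K * K => (p.1 * p.2)%g) _
  (@mulK_continuous (a, b))).
exact: (@cvg_pair _ _ _ _ (nbhs a) (nbhs b)).
Qed.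

Lemma cvg_invK T (G : set_system T) {FG : Filter G} (f : T -> K) a :
  f @ G --> a -> (f x)^-1%g @[x --> G] --> (a^-1)%g.
Proof. by move=> fa; apply: (cvg_comp f _ fa); exact: invK_continuous. Qed.

Lemma smooth_near_chartK c c' k : AK c -> AK c' -> cdom c k -> cdom c' k ->
  smooth_near (cmap c k) (cmap c' \o cinv c).
Proof.
move=> Ac Ac' ck c'k; have [Eh _ [_ _ /(_ c c' Ac Ac') S] _ _] := K_lie.
apply: (smooth_on_near Eh S).
have [O [Oo Ok OP]] := chart_nbhs (atlasK Ac) ck (chart_dom_nbhs (atlasK Ac') c'k).
apply: filterS (open_nbhs_nbhs (conj Oo Ok)) => z Oz.
have [zc zc'] := OP z Oz I; have [zd zE] := chart_invK (atlasK Ac) zc.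
by exists (cinv c z).
Qed.

Lemma smooth_near_mulK c1 c2 c3 a b : AK c1 -> AK c2 -> AK c3 ->
  cdom c1 a -> cdom c2 b -> cdom c3 (a * b)%g ->
  smooth_near (cmap c1 a, cmap c2 b)
    (fun p : E * E => cmap c3 (cinv c1 p.1 * cinv c2 p.2)%g).
Proof.
move=> A1 A2 A3 c1a c2b c3ab.
have [Eh _ _ [_ /(_ (prod_chart c1 c2) c3) S] _] := K_lie.
have {}S : smooth_on _ _ := S (ex_intro2 _ _ (c1, c2) (conj A1 A2) erefl) A3.
apply: (smooth_on_near Eh S).
have [[N1 N2] /= [N1a N2b] N] := @mulK_continuous (a, b) _
  (chart_dom_nbhs (atlasK A3) c3ab).
have [O1 [O1o O1a O1P]] := chart_nbhs (atlasK A1) c1a N1a.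
have [O2 [O2o O2b O2P]] := chart_nbhs (atlasK A2) c2b N2b.
exists (O1, O2); first by split; exact: open_nbhs_nbhs.
move=> [z1 z2] [/= Oz1 Oz2].
have [z1c zN1] := O1P z1 Oz1 I; have [z1d z1E] := chart_invK (atlasK A1) z1c.
have [z2c zN2] := O2P z2 Oz2 I; have [z2d z2E] := chart_invK (atlasK A2) z2c.
exists (cinv c1 z1, cinv c2 z2); last by rewrite /= z1E z2E.
by split; [split=> //; split|exact: (N (cinv c1 z1, cinv c2 z2))].
Qed.

Lemma smooth_near_invK c1 c2 a : AK c1 -> AK c2 ->
  cdom c1 a -> cdom c2 (a^-1)%g ->
  smooth_near (cmap c1 a) (fun p : E => cmap c2 (cinv c1 p)^-1%g).
Proof.
move=> A1 A2 c1a c2a.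
have [Eh _ _ _ [_ /(_ c1 c2 A1 A2) S]] := K_lie.
apply: (smooth_on_near Eh S).
have [O1 [O1o O1a O1P]] := chart_nbhs (atlasK A1) c1a
  (invK_continuous (chart_dom_nbhs (atlasK A2) c2a)).
apply: filterS (open_nbhs_nbhs (conj O1o O1a)) => z Oz.
have [zc zN] := O1P z Oz I; have [zd zE] := chart_invK (atlasK A1) zc.
by exists (cinv c1 z).
Qed.

(** One chart of K around the value is enough: by [smooth_grp_chart] any other chart
    around it gives the same notion. *)
Definition smooth_grp (k : M -> K) (x : M) : Prop :=
  exists c, [/\ AK c, \forall y \near x, cdom c (k y) & smooth_vec AM (cmap c \o k) x].

Lemma smooth_grp_inv_chart (h : M -> E) x c : AK c -> smooth_vec AM h x ->
  ccod c (h x) -> smooth_grp (cinv c \o h) x.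
Proof.
move=> Ac hS hx.
have [dx hxE] := chart_invK (atlasK Ac) hx.
have [O [Oo]] := chart_nbhs (atlasK Ac) dx (chart_dom_nbhs (atlasK Ac) dx).
rewrite hxE => Ox OP.
have Oh : \forall y \near x, O (h y).
  by apply: (smooth_vec_continuous M_atlas hS); exact: open_nbhs_nbhs.
have Ocod : \forall y \near x, ccod c (h y).
  by apply: filterS Oh => y /OP -/(_ I)[].
exists c; split=> //.
  by apply: filterS Ocod => y /(chart_invK (atlasK Ac))[].
apply: smooth_vec_eq hS.
by apply: filterS Ocod => y /(chart_invK (atlasK Ac))[_ /= ->].
Qed.

Lemma smooth_grp_continuous k x : smooth_grp k x -> {for x, continuous k}.
Proof.
move=> [c [Ac ck hS]]; have kx := nbhs_singleton ck.
move=> N Nk; have [O [Oo Ok OP]] := chart_nbhs (atlasK Ac) kx Nk.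
have Oh : \forall y \near x, O ((cmap c \o k) y).
  by apply: (smooth_vec_continuous M_atlas hS); exact: open_nbhs_nbhs.
have : \forall y \near x, N (k y).
  apply: filterS2 Oh ck => y /OP -/(_ I)[_ +] cy.
  by rewrite /= (chartK (atlasK Ac)).
by [].
Qed.

Lemma smooth_grp_chart k x c : smooth_grp k x -> AK c -> cdom c (k x) ->
  smooth_vec AM (cmap c \o k) x.
Proof.
move=> [c' [Ac' ck' hS]] Ac ck; have kx := nbhs_singleton ck'.
have := smooth_vec_comp hS (smooth_near_chartK Ac' Ac kx ck).
apply: smooth_vec_eq; apply: filterS ck' => y c'y /=.
by rewrite (chartK (atlasK Ac')).
Qed.

Lemma smooth_grp_chart_dom k x c : smooth_grp k x -> AK c -> cdom c (k x) ->
  \forall y \near x, cdom c (k y).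
Proof.
move=> kS Ac ck; apply: (smooth_grp_continuous kS).
exact: (chart_dom_nbhs (atlasK Ac)).
Qed.

Lemma smooth_grp_eq k k' x :
  (\forall y \near x, k y = k' y) -> smooth_grp k x -> smooth_grp k' x.
Proof.
move=> kk' [c [Ac ck kS]]; exists c; split=> //.
  by apply: filterS2 kk' ck => y <-.
by apply: smooth_vec_eq kS; apply: filterS kk' => y /= ->.
Qed.

Lemma smooth_grp_near k x : smooth_grp k x -> \forall y \near x, smooth_grp k y.
Proof.
move=> [c [Ac ck kS]].
have kS' := smooth_vec_near M_atlas kS; have ck' := near_join ck.
by apply: filterS2 kS' ck' => y; exists c.
Qed.

Lemma smooth_grp_cst (a : K) x : smooth_grp (fun=> a) x.
Proof.
have [c Ac ca] := atlasK_cover a; exists c; split=> //; first exact: nearW.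
exact: smooth_vec_cst.
Qed.

Lemma smooth_grpM k k' x :
  smooth_grp k x -> smooth_grp k' x -> smooth_grp (fun y => (k y * k' y)%g) x.
Proof.
move=> kS kS'.
have [c1 A1 c1k] := atlasK_cover (k x); have [c2 A2 c2k] := atlasK_cover (k' x).
have [c3 A3 c3k] := atlasK_cover (k x * k' x)%g.
exists c3; split=> //.
  have := cvg_mulK (smooth_grp_continuous kS) (smooth_grp_continuous kS').
  by apply; exact: (chart_dom_nbhs (atlasK A3)).
have := smooth_vec_comp (smooth_vec_pair M_atlas (smooth_grp_chart kS A1 c1k)
  (smooth_grp_chart kS' A2 c2k)) (smooth_near_mulK A1 A2 A3 c1k c2k c3k).
apply: smooth_vec_eq.
apply: filterS2 (smooth_grp_chart_dom kS A1 c1k) (smooth_grp_chart_dom kS' A2 c2k).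
by move=> y c1y c2y /=; rewrite (chartK (atlasK A1))// (chartK (atlasK A2)).
Qed.

Lemma smooth_grpV k x : smooth_grp k x -> smooth_grp (fun y => (k y)^-1%g) x.
Proof.
move=> kS; have [c1 A1 c1k] := atlasK_cover (k x).
have [c2 A2 c2k] := atlasK_cover (k x)^-1%g.
exists c2; split=> //.
  have := cvg_invK (smooth_grp_continuous kS).
  by apply; exact: (chart_dom_nbhs (atlasK A2)).
have := smooth_vec_comp (smooth_grp_chart kS A1 c1k) (smooth_near_invK A1 A2 c1k c2k).
apply: smooth_vec_eq; apply: filterS (smooth_grp_chart_dom kS A1 c1k) => y c1y /=.
by rewrite (chartK (atlasK A1)).
Qed.

Lemma smooth_map_grpP (W : set M) (k : M -> K) : open W ->
  smooth_map smooth_sub AM AK W k <-> forall x, W x -> smooth_grp k x.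
Proof.
move=> Wo; split=> [[kc kS] x Wx|kS].
  have [_ /(_ x)[c Ac cx] _] := M_atlas; have [c' Ac' ck] := atlasK_cover (k x).
  have kcx := within_openP Wo kc Wx.
  have ck' : \forall y \near x, cdom c' (k y).
    by apply: kcx; exact: (chart_dom_nbhs (atlasK Ac')).
  exists c'; split=> //; exists c; split=> //.
  have [|U [g [Uo Ux gS gE]]] := kS c c' Ac Ac' (cmap c x).
    by exists x.
  exists g.
    apply: smooth_on_near gS _; last exact: open_nbhs_nbhs.
    by have [] := K_lie.
  have Uc : \forall y \near x, U (cmap c y).
    by apply: (chart_continuous (atlasM M_atlas Ac) cx); exact: open_nbhs_nbhs.
  have cc := chart_dom_nbhs (atlasM M_atlas Ac) cx.
  have Wn := open_nbhs_nbhs (conj Wo Wx).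
  near=> y.
  have cy : cdom c y by near: y.
  rewrite gE /=; first by rewrite (chartK (atlasM M_atlas Ac)).
    by exists y => //; split; [split=> //; near: y|near: y].
  by near: y.
split; first by apply: openP_within => // x /kS; exact: smooth_grp_continuous.
move=> c c' Ac Ac' _ [x [[cx Wx] ck] <-].
have [G [O [Oo Ox GC]] Gh] :=
  smooth_vec_chart M_atlas (smooth_grp_chart (kS x Wx) Ac' ck) Ac cx.
have [O' [O'o O'x O'P]] := chart_nbhs (atlasM M_atlas Ac) cx Gh.
exists (O `&` O'), G; split=> //; first exact: openI.
  apply: Ck_smooth_on; [by have [] := K_lie|exact: openI|].
  by move=> n; apply: Ck_sub (GC n) => z [].
move=> _ [y [[cy Wy] ky] <-] [_ Oy].
have [_] := O'P _ Oy (chart_mod (atlasM M_atlas Ac) cy).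
by rewrite /= (chartK (atlasM M_atlas Ac)).
Unshelve. all: by end_near. Qed.

End SmoothGroupValued.

(** * Compactness, local finiteness and plateau functions on M *)

Section Topology.

(** Induction over a compact set, replacing the choice of a finite subcover: a
    property of sets that holds locally and passes to unions of two sets holds for
    the whole compact set. *)
Lemma compact_ind (X : topologicalType) (A : set X) (Pr : set X -> Prop) :
  compact A -> Pr set0 -> (forall B C, Pr B -> Pr C -> Pr (B `|` C)) ->
  (forall B C, B `<=` C -> Pr C -> Pr B) ->
  (forall x, A x -> exists2 Z, nbhs x Z & Pr Z) -> Pr A.
Proof.
move=> Ac P0 PU PW Ploc; apply: contrapT => nPA.
pose G : set_system X := [set B | exists2 Z, Pr Z & A `\` Z `<=` B].
have GF : ProperFilter G.
  split.
    move=> [Z PZ AZ]; apply: nPA; apply: PW PZ => x Ax; apply: contrapT => nZx.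
    exact: (AZ x).
  split; first by exists set0.
    move=> B C [Z PZ AB] [Z' PZ' AC]; exists (Z `|` Z'); first exact: PU.
    move=> x [Ax nZ]; split; [apply: AB|apply: AC]; split=> // Zx; apply: nZ.
      by left.
    by right.
  by move=> B C BC [Z PZ AB]; exists Z => //; exact: subset_trans BC.
have GA : G A by exists set0 => // x [].
have [x [Ax clx]] := Ac G GF GA.
have [Z Zx PZ] := Ploc x Ax.
by have [y [[_ nZy] Zy]] : (A `\` Z) `&` Z !=set0 by apply: clx => //; exists Z.
Qed.

Context {X : topologicalType}.

Definition loc_finite (F : set (set X)) : Prop :=
  forall x : X, exists2 N, nbhs x N & finite_set [set B | F B /\ B `&` N !=set0].

Lemma loc_finite_closed (F J : set (set X)) : loc_finite F -> J `<=` F ->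
  closed (\bigcup_(B in J) closure B).
Proof.
move=> Flf JF x clx; have [N Nx Nfin] := Flf x.
pose S := [set B | J B /\ B `&` N !=set0].
have Sfin : finite_set S by apply: sub_finite_set Nfin => B [/JF FB BN].
have Dcl : closed (\bigcup_(B in S) closure B).
  by apply: closed_bigcup => // B _; exact: closed_closure.
have [[B [JB _] Bx]|nDx] := pselect ((\bigcup_(B in S) closure B) x).
  by exists B.
have : nbhs x (N° `&` ~` (\bigcup_(B in S) closure B)).
  apply: filterI; first exact: nbhs_interior.
  by apply: open_nbhs_nbhs; split=> //; exact: closed_openC.
move=> /clx[y [[B JB By] [Ny nDy]]]; exfalso; apply: nDy; exists B => //; split=> //.
exact: By.
Qed.

Lemma closure_loc_finite (F J : set (set X)) : loc_finite F -> J `<=` F ->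
  closure (\bigcup_(B in J) B) `<=` \bigcup_(B in J) closure B.
Proof.
move=> Flf JF; rewrite closureE => x; apply; split.
  exact: loc_finite_closed Flf JF.
by move=> y [B JB By]; exists B => //; exact: subset_closure.
Qed.

(** The open sets that either miss C or have their closure in V cover X. In a locally
    finite refinement, T is the union of the members that meet C: its closure is the
    union of their closures. *)
Lemma paracompact_normal (C V : set X) : paracompact X ->
  (forall (x : X) N, nbhs x N -> exists Z, [/\ nbhs x Z, closed Z & Z `<=` N]) ->
  closed C -> open V -> C `<=` V ->
  exists T, [/\ open T, C `<=` T & closure T `<=` V].
Proof.
move=> Xp reg Ccl Vo CV.
pose U := [set O : set X | open O /\ (O `&` C !=set0 -> closure O `<=` V)].
have Ucov x : exists2 A, U A & A x.
  have [Cx|nCx] := pselect (C x).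
    have [Z [Zx Zc ZV]] := reg x V (open_nbhs_nbhs (conj Vo (CV x Cx))).
    exists Z°; last exact: Zx.
    split; first exact: open_interior.
    move=> _; apply: subset_trans ZV; rewrite [X in _ `<=` X](closure_id Z).1//.
    by apply: closureS; exact: interior_subset.
  exists (~` C) => //; split; first exact: closed_openC.
  by move=> [y []].
have [W [Wo Wcov WU Wlf]] := Xp U (fun O => @proj1 _ _) Ucov.
pose J := [set B | W B /\ B `&` C !=set0].
exists (\bigcup_(B in J) B); split.
- by apply: bigcup_open => B [/Wo].
- move=> x Cx; have [B WB Bx] := Wcov x; exists B => //; split=> //.
  by exists x.
move=> x /(closure_loc_finite Wlf)[]; first by move=> B [].
move=> B [WB [y [By Cy]]] Bx; have [A [Ao AV] BA] := WU B WB.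
apply: AV; first by exists y; split=> //; exact: BA.
exact: closureS Bx.
Qed.

End Topology.

Section ManifoldTopology.
Context {R : realType} {d : nat} {M : topologicalType} (AM : set (chart M 'rV[R]_d)).
Hypothesis (M_haus : hausdorff_space M)
  (M_atlas : smooth_atlas (@corner R d) smooth_sub AM).

Definition box (x : 'rV[R]_d) (r : R) : set 'rV[R]_d :=
  [set z | corner z /\ forall i, `|z ord0 i - x ord0 i| <= r].

Lemma near_box (x : 'rV[R]_d) (r : R) : 0 < r ->
  \forall z \near x, forall i, `|(z : 'rV[R]_d) ord0 i - x ord0 i| <= r.
Proof.
move=> r0; apply/nbhs_ballP; exists r => //= z zr i.
have [_ /(_ ord0 i)] := zr.
by rewrite /ball /= distrC => /ltW.
Qed.

Lemma box_compact x r : compact (box x r).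
Proof.
have -> : box x r = [set z : 'rV[R]_d | forall i : 'I_d,
    (`[x ord0 i - r, x ord0 i + r] `&` [set t : R | 0 <= t]) (z ord0 i)].
  apply/seteqP; split=> z /=.
    move=> [zc zr] i; split; last exact: zc.
    by rewrite /= in_itv /= -ler_distl.
  move=> h; split=> i; first by have [] := h i.
  by have [+ _] := h i; rewrite /= in_itv /= -ler_distl.
apply: (@rV_compact R d (fun i => `[x ord0 i - r, x ord0 i + r] `&` [set t : R | 0 <= t])).
by move=> i; apply: compact_closedI; [exact: segment_compact|exact: closed_ge].
Qed.

(** Z corresponds in a chart to a compact box of the model. Being compact it is closed
    in M, so that the plateau function of the box extends by 0 to a smooth function
    on M. *)
Lemma exists_bump (x : M) (N : set M) : nbhs x N ->
  exists (Z : set M) (b : M -> R^o),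
    [/\ [/\ nbhs x Z, compact Z, closed Z & Z `<=` N],
        forall y, smooth_vec AM b y, forall y, 0 <= b y <= 1,
        \forall y \near x, b y = 1 & forall y, ~ Z y -> b y = 0].
Proof.
move=> Nx; have [_ /(_ x)[c Ac cx] _] := M_atlas; have cC := atlasM M_atlas Ac.
have [O [Oo Ox OP]] := chart_nbhs cC cx Nx.
have [r r0 rO] : exists2 r : R, 0 < r & box (cmap c x) r `<=` O.
  have /nbhs_ballP[e /= e0 eO] := open_nbhs_nbhs (conj Oo Ox).
  exists (e / 2); first by rewrite divr_gt0.
  move=> z [_ zr]; apply: eO; split=> // i j; rewrite !ord1 /ball /= distrC.
  by apply: le_lt_trans (zr j) _; rewrite ltr_pdivrMr// mulr_natr mulr2n ltrDl.
have boxP z : box (cmap c x) r z -> ccod c z /\ N (cinv c z).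
  by move=> zb; apply: OP; [exact: rO|exact: zb.1].
pose Z := cinv c @` box (cmap c x) r.
have Zcpt : compact Z.
  apply: continuous_compact; last exact: box_compact.
  have [_ _ [_ _ _ ic]] := cC; apply: continuous_subspaceW ic.
  by move=> z /boxP[].
have Zcl : closed Z by exact: compact_closed.
have ZE y : cdom c y -> (forall i, `|cmap c y ord0 i - cmap c x ord0 i| <= r) -> Z y.
  move=> cy yr; exists (cmap c y); last exact: (chartK cC).
  by split=> //; exact: (chart_mod cC).
have [b [bC b01 b1 b0]] := bump_rV (cmap c x) r0.
exists Z, (fun y => if `[< cdom c y >] then b (cmap c y) else 0).
have near_c s : 0 < s ->
    \forall y \near x, forall i, `|cmap c y ord0 i - cmap c x ord0 i| <= s.
  by move=> s0; exact: (chart_continuous cC cx (near_box (cmap c x) s0)).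
have Z0 y : ~ Z y -> (if `[< cdom c y >] then b (cmap c y) else 0) = 0 :> R^o.
  move=> nZy; case: asboolP => // cy; apply: b0.
  apply: contrapT => h; apply: nZy; apply: ZE => // i; rewrite leNgt; apply/negP => ri.
  by apply: h; exists i; exact: ltW.
split=> //.
- split=> //.
    by apply: filterS2 (chart_dom_nbhs cC cx) (near_c r r0) => y; exact: ZE.
  by move=> _ [z zb <-]; have [] := boxP z zb.
- move=> y; have [cy|ncy] := pselect (cdom c y).
    exists c; split=> //; exists b; first exact: smooth_nearT.
    apply: filterS (chart_dom_nbhs cC cy) => y' cy'.
    by case: asboolP.
  apply: (@smooth_vec_eq _ _ _ _ R^o (fun=> 0)); last exact: smooth_vec_cst.
  have nZy : ~ Z y.
    by move=> [z /boxP[zc _] zy]; apply: ncy; rewrite -zy; have [] := chart_invK cC zc.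
  have : nbhs y (~` Z) by apply: open_nbhs_nbhs; split=> //; exact: closed_openC.
  by apply: filterS => y' /Z0 ->.
- by move=> y; case: asboolP => // _; rewrite lexx ler01.
- have r20 : 0 < r / 2 by rewrite divr_gt0.
  apply: filterS2 (chart_dom_nbhs cC cx) (near_c (r / 2) r20) => y cy yr.
  by case: asboolP => // _; exact: b1.
Qed.

End ManifoldTopology.

(** * Germs of sections of a principal bundle *)

Section BundleSections.
Context {R : realType} {E : tvsType R} {K : preTopologicalGroupType}
  (AK : set (chart K E)) {d : nat} {M : topologicalType} (AM : set (chart M 'rV[R]_d)).
Hypothesis (K_lie : lie_group AK) (M_atlas : smooth_atlas (@corner R d) smooth_sub AM).
Context {P : principal_bundle K M}.

Local Notation is_triv := (is_loc_triv (@bact K M P) (@bproj K M P)).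

Lemma exists_triv x : exists2 t : loc_triv K M P, is_triv t & tdom t x.
Proof.
have [L [Lt _ /(_ x I)[t tL tx]]] := loc_trivial P.
by exists t => //; exact: Lt.
Qed.

Section OneTriv.
Variables (t : loc_triv K M P).
Hypothesis tP : is_triv t.

Lemma tmap_tinv y k : tdom t y -> tmap t (tinv t (y, k)) = (y, k).
Proof. by move=> ty; have [_ [_ h _ _] _ _] := tP; have [] := h (y, k) (conj ty I). Qed.

Lemma bproj_tinv y k : tdom t y -> bproj (tinv t (y, k)) = y.
Proof.
move=> ty; have [_ [_ h _ _] e _] := tP; have [dy _] := h (y, k) (conj ty I).
by rewrite -e// tmap_tinv.
Qed.

Lemma bproj_tsec y : tdom t y -> bproj (tsec t y) = y.
Proof. exact: bproj_tinv. Qed.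

Lemma tmapK (p : P) : tdom t (bproj p) -> tinv t (tmap t p) = p.
Proof. by move=> tp; have [_ [h _ _ _] _ _] := tP; have [] := h p tp. Qed.

Lemma bact_tsec y k : tdom t y -> bact (tsec t y) k = tinv t (y, k).
Proof.
move=> ty; have [_ _ _ e] := tP.
rewrite -[LHS]tmapK ?bproj_bact ?bproj_tsec//.
by rewrite e ?bproj_tsec// tmap_tinv//= mul1g.
Qed.

Lemma tmap_tsec (p : P) : tdom t (bproj p) -> p = bact (tsec t (bproj p)) (tmap t p).2.
Proof.
move=> tp; have [_ _ e _] := tP.
by rewrite bact_tsec// -[X in (X, _)]e// -surjective_pairing tmapK.
Qed.

Lemma bact_inj_triv (p : P) k k' : tdom t (bproj p) -> bact p k = bact p k' -> k = k'.
Proof.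
move=> tp pk; have [_ _ _ e] := tP.
by have := e p k tp; rewrite pk e// => -[] /mulgI.
Qed.

End OneTriv.

Lemma bact_inj (p : P) k k' : bact p k = bact p k' -> k = k'.
Proof. by have [t tP tp] := exists_triv (bproj p); exact: (bact_inj_triv tP). Qed.

(** The quotient p^-1 q of two points of the same fibre; the default value 1 is taken
    on pairs of points of different fibres. *)
Definition fdiv (p q : P) : K := xget 1%g [set k | bact p k = q].

Lemma fdiv_bact (p : P) k : fdiv p (bact p k) = k.
Proof. by apply: xget_unique => //= k' /bact_inj. Qed.

Lemma bact_fdiv (p q : P) : bproj p = bproj q -> bact p (fdiv p q) = q.
Proof.
move=> pq; have [t tP tp] := exists_triv (bproj p).
have qE := tmap_tsec tP (_ : tdom t (bproj q)); rewrite -pq in qE.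
have pE := tmap_tsec tP tp.
set a := (tmap t p).2 in pE; set b := (tmap t q).2 in qE.
have -> : q = bact p (a^-1 * b)%g by rewrite pE bactM mulgA mulgV mul1g -qE.
by rewrite fdiv_bact.
Qed.

Lemma fdivM (p q : P) k : bproj p = bproj q -> fdiv p (bact q k) = (fdiv p q * k)%g.
Proof. by move=> /bact_fdiv {1}<-; rewrite bactM fdiv_bact. Qed.

Definition cont_grp (k : M -> K) (x : M) : Prop :=
  \forall y \near x, {for y, continuous k}.

(** What is needed of a class of K-valued germs for [germ_rel] to be an equivalence
    relation that is open in the base point; it is used for continuous and for smooth
    germs. *)
Definition germ_class (Q : (M -> K) -> M -> Prop) : Prop :=
  [/\ forall a x, Q (fun=> a) x,
      forall k k' x, Q k x -> Q k' x -> Q (fun y => (k y * k' y)%g) x,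
      forall k x, Q k x -> Q (fun y => (k y)^-1%g) x
    & forall k x, Q k x -> \forall y \near x, Q k y].

Lemma cont_grp_class : germ_class cont_grp.
Proof.
split.
- by move=> a x; apply: nearW => y; exact: cvg_cst.
- move=> k k' x; apply: filterS2 => y ky k'y; exact: (cvg_mulK K_lie).
- move=> k x; apply: filterS => y ky; exact: (cvg_invK K_lie).
- by move=> k x /near_join.
Qed.

Lemma smooth_grp_class : germ_class (smooth_grp AK AM).
Proof.
split.
- by move=> a x; exact: smooth_grp_cst.
- by move=> k k' x; exact: smooth_grpM.
- by move=> k x; exact: smooth_grpV.
- by move=> k x; exact: smooth_grp_near.
Qed.

Definition germ_rel (Q : (M -> K) -> M -> Prop) (y : M) (s s' : M -> P) : Prop :=
  exists2 k, Q k y & \forall z \near y, s' z = bact (s z) (k z).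

Section GermRel.
Variable Q : (M -> K) -> M -> Prop.
Hypothesis QC : germ_class Q.

Lemma germ_rel_refl y s : germ_rel Q y s s.
Proof.
have [Qc _ _ _] := QC; exists (fun=> 1%g); first exact: Qc.
by apply: nearW => z; rewrite bact1.
Qed.

Lemma germ_rel_sym y s s' : germ_rel Q y s s' -> germ_rel Q y s' s.
Proof.
have [_ _ Qv _] := QC; move=> [k kQ ks]; exists (fun z => (k z)^-1%g); first exact: Qv.
by apply: filterS ks => z ->; rewrite bactM mulgV bact1.
Qed.

Lemma germ_rel_trans y s s' s'' :
  germ_rel Q y s s' -> germ_rel Q y s' s'' -> germ_rel Q y s s''.
Proof.
have [_ Qm _ _] := QC; move=> [k kQ ks] [k' kQ' ks'].
exists (fun z => (k z * k' z)%g); first exact: Qm.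
by apply: filterS2 ks ks' => z ss' ->; rewrite ss' bactM.
Qed.

Lemma germ_rel_near y s s' :
  germ_rel Q y s s' -> \forall z \near y, germ_rel Q z s s'.
Proof.
have [_ _ _ Qn] := QC; move=> [k /Qn kQ /near_join ks].
by apply: filterS2 kQ ks => z; exists k.
Qed.

Lemma germ_rel_eq y s s' : (\forall z \near y, s z = s' z) -> germ_rel Q y s s'.
Proof.
have [Qc _ _ _] := QC; exists (fun=> 1%g); first exact: Qc.
by near=> z; rewrite bact1; near: z; apply: filterS H => z ->.
Unshelve. all: by end_near. Qed.

End GermRel.

(** The continuity of [tmap t] is known relatively to the preimage of its domain;
    this suffices because tsec t' takes its values there near y. *)
Lemma tsec_rel t t' y : is_triv t -> is_triv t' -> tdom t y -> tdom t' y ->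
  germ_rel cont_grp y (tsec t) (tsec t').
Proof.
move=> tP t'P ty t'y; exists (fun z => (tmap t (tsec t' z)).2); last first.
  have [to _ _ _] := tP; have [t'o _ _ _] := t'P.
  apply: filterS2 (open_nbhs_nbhs (conj to ty)) (open_nbhs_nbhs (conj t'o t'y)).
  move=> z tz t'z; rewrite [LHS](tmap_tsec tP); first by rewrite bproj_tsec.
  by rewrite bproj_tsec.
have [to [_ _ tc _] _ _] := tP; have [t'o [_ _ _ t'c] _ _] := t'P.
apply: filterS2 (open_nbhs_nbhs (conj to ty)) (open_nbhs_nbhs (conj t'o t'y)).
move=> z tz t'z.
have t'cz : tsec t' w @[w --> z] --> tsec t' z.
  apply: (cvg_comp (fun w => (w, 1%g : K)) (tinv t') (G := nbhs (z, 1%g : K))).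
    by apply: cvg_pair; [exact: cvg_id|exact: cvg_cst].
  by apply: (within_openP (open_prodT t'o) t'c).
have tcz : tmap t @ within (@bproj K M P @^-1` tdom t) (nbhs (tsec t' z)) -->
    tmap t (tsec t' z).
  by move/subspace_continuousP: tc; apply; rewrite /= bproj_tsec.
have c1 : tmap t (tsec t' w) @[w --> z] --> tmap t (tsec t' z).
  apply: (cvg_comp (tsec t') (tmap t) _ tcz) => N /t'cz.
  rewrite /= !near_simpl => Nz.
  apply: filterS3 Nz (open_nbhs_nbhs (conj to tz)) (open_nbhs_nbhs (conj t'o t'z)).
  by move=> w + tw t'w; apply; rewrite /= bproj_tsec.
by apply: (cvg_comp (fun w => tmap t (tsec t' w)) snd c1); exact: cvg_snd.
Qed.

(** Continuity of a section is read in a trivialization and not in the topology of P,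
    which is only known over the domain of each trivialization. *)
Definition csec (s : M -> P) (y : M) : Prop :=
  exists t, [/\ is_triv t, tdom t y & germ_rel cont_grp y (tsec t) s].

Lemma csec_tsec t y : is_triv t -> tdom t y -> csec (tsec t) y.
Proof. by move=> tP ty; exists t; split=> //; exact: germ_rel_refl cont_grp_class _ _. Qed.

Lemma csec_rel s s' y : csec s y -> csec s' y -> germ_rel cont_grp y s s'.
Proof.
move=> [t [tP ty ts]] [t' [t'P t'y ts']].
apply: (germ_rel_trans cont_grp_class (germ_rel_sym cont_grp_class ts)).
exact: (germ_rel_trans cont_grp_class (tsec_rel tP t'P ty t'y)).
Qed.

Lemma csec_trans s s' y : csec s y -> germ_rel cont_grp y s s' -> csec s' y.
Proof.
move=> [t [tP ty ts]] ss'; exists t; split=> //.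
exact: (germ_rel_trans cont_grp_class ts).
Qed.

Lemma csec_near s y : csec s y -> \forall z \near y, csec s z.
Proof.
move=> [t [tP ty /(germ_rel_near cont_grp_class) ts]]; have [to _ _ _] := tP.
by apply: filterS2 (open_nbhs_nbhs (conj to ty)) ts => z tz tsz; exists t.
Qed.

Lemma csec_bproj s y : csec s y -> bproj (s y) = y.
Proof.
by move=> [t [tP ty [k _ /nbhs_singleton ->]]]; rewrite bproj_bact bproj_tsec.
Qed.

Lemma csec_fdiv s s' y : csec s y -> csec s' y -> s' y = bact (s y) (fdiv (s y) (s' y)).
Proof. by move=> sy s'y; rewrite bact_fdiv// !csec_bproj. Qed.

Lemma csec_fdiv_continuous s s' y : csec s y -> csec s' y ->
  {for y, continuous (fun z => fdiv (s z) (s' z))}.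
Proof.
move=> sy s'y; have [k /nbhs_singleton kc ks] := csec_rel sy s'y.
have kE : \forall z \near y, k z = fdiv (s z) (s' z).
  by apply: filterS ks => z ->; rewrite fdiv_bact.
rewrite /prop_for /continuous_at -(nbhs_singleton kE).
by apply: cvg_trans kc; apply: near_eq_cvg; exact: kE.
Qed.

Lemma germ_rel_fdiv y s s' : germ_rel (smooth_grp AK AM) y s s' ->
  smooth_grp AK AM (fun z => fdiv (s z) (s' z)) y.
Proof.
move=> [k kS ks]; apply: (smooth_grp_eq _ kS).
by apply: filterS ks => z ->; rewrite fdiv_bact.
Qed.

End BundleSections.

(** * Contracting a section inside a chart of the group *)

Lemma chart_inv_continuous (X Y : topologicalType) (c : chart X Y) z :
  is_chart setT c -> ccod c z -> {for z, continuous (cinv c)}.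
Proof.
move=> cC zc; have [xc xz] := chart_invK cC zc => N Nz.
have [O [Oo Ox OP]] := chart_nbhs cC xc Nz; rewrite xz in Ox.
by apply: filterS (open_nbhs_nbhs (conj Oo Ox)) => w Ow; have [] := OP w Ow I.
Qed.

Lemma chart_cod_nbhs (X Y : topologicalType) (c : chart X Y) z :
  is_chart setT c -> ccod c z -> nbhs z (ccod c).
Proof.
move=> cC zc; have [_ [O Oo e] _] := cC; rewrite e setIT in zc *.
exact: open_nbhs_nbhs.
Qed.

Section Smoothing.
Context {R : realType} {E : tvsType R} {K : preTopologicalGroupType}
  (AK : set (chart K E)) {d : nat} {M : topologicalType} (AM : set (chart M 'rV[R]_d)).
Hypothesis (K_lie : lie_group AK) (M_haus : hausdorff_space M)
  (M_atlas : smooth_atlas (@corner R d) smooth_sub AM).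
Context {P : principal_bundle K M}.

Local Notation cgc := (cont_grp_class K_lie).
Local Notation sgc := (smooth_grp_class K_lie M_atlas).
Local Notation smooth_rel := (germ_rel (smooth_grp AK AM)).

Definition mix (e : E) (p : R^o * E) : E := (1 - p.1) *: p.2 + (p.1 : R) *: e.

Lemma Ck_mix e n : Ck n setT (mix e).
Proof.
apply: Ck_add; first exact: openT.
  apply: Ck_scale; [exact: openT| |exact: Ck_snd].
  apply: Ck_add; [exact: openT|exact: Ck_cst|].
  have : Ck n setT (fun p : R^o * E => (-1 : R^o) *: (p.1 : R^o)).
    by apply: Ck_scale; [exact: openT|exact: Ck_cst|exact: Ck_fst].
  by apply: Ck_eq => [|p _]; [exact: openT|rewrite scaleN1r].
by apply: Ck_scale; [exact: openT|exact: Ck_fst|exact: Ck_cst].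
Qed.

Section Contraction.
Variables (s : M -> P) (c : chart K E) (Y : set M).
Hypotheses (Ac : AK c) (sY : forall y, Y y -> csec s y).

Definition coord (tau : M -> P) (y : M) : E := cmap c (fdiv (s y) (tau y)).

Lemma coord_continuous_at tau y : Y y -> csec tau y -> cdom c (fdiv (s y) (tau y)) ->
  {for y, continuous (coord tau)}.
Proof.
move=> Yy ty cy.
apply: (cvg_comp (fun z => fdiv (s z) (tau z)) (cmap c)).
  exact: (csec_fdiv_continuous K_lie (sY Yy) ty).
exact: (chart_continuous (atlasK K_lie Ac)).
Qed.

(** The elementary modification: tau is moved towards the constant e, in the chart c
    and relatively to the reference section s, with weight b. Where b = 1 the new
    section is s times a constant; where tau is smooth relatively to s it stays so,
    b being smooth; off Z nothing changes. *)
Lemma contract_section (tau : M -> P) (b : M -> R^o) (Z : set M) (e : E) :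
  (forall y, Y y -> csec tau y) ->
  (forall y, Y y -> cdom c (fdiv (s y) (tau y))) ->
  (forall y, smooth_vec AM b y) -> closed Z -> Z `<=` Y° ->
  (forall y, ~ Z y -> b y = 0) ->
  (forall y, Y y -> ccod c (mix e (b y, coord tau y))) ->
  exists tau' : M -> P,
    [/\ forall y, ~ Z y -> \forall z \near y, tau z = tau' z,
        forall y, csec tau y -> csec tau' y,
        forall y, Y y -> cdom c (fdiv (s y) (tau' y)) /\
          coord tau' y = mix e (b y, coord tau y),
        forall y, Y° y -> smooth_rel y s tau -> smooth_rel y s tau'
      & forall y, Y° y -> (\forall z \near y, b z = 1) -> smooth_rel y s tau'].
Proof.
move=> tauY tauc bS Zcl ZY b0 mixc.
pose H y := mix e (b y, coord tau y).
pose tau' y := if `[< Z y >] then bact (s y) (cinv c (H y)) else tau y.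
have cC := atlasK K_lie Ac.
have offZ y : ~ Z y -> \forall z \near y, tau z = tau' z.
  move=> nZy; have : nbhs y (~` Z) by apply: open_nbhs_nbhs; split=> //; exact: closed_openC.
  by apply: filterS => z nZz; rewrite /tau'; case: asboolP.
have tau'E y : Y y -> tau' y = bact (s y) (cinv c (H y)).
  move=> Yy; rewrite /tau'; case: asboolP => // nZy.
  rewrite /H /mix b0// subr0 scale1r scale0r addr0 (chartK cC); last exact: tauc.
  exact: csec_fdiv (sY Yy) (tauY y Yy).
have near_tau' y : Y° y -> \forall z \near y, tau' z = bact (s z) (cinv c (H z)).
  by apply: filterS => z /tau'E.
have smooth_case y : Y° y -> smooth_vec AM H y -> smooth_rel y s tau'.
  move=> Yy HS; exists (cinv c \o H); last exact: near_tau'.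
  apply: (smooth_grp_inv_chart K_lie M_atlas Ac HS).
  by apply: mixc; exact: nbhs_singleton.
have contH y : Y y -> {for y, continuous H}.
  move=> Yy; apply: (cvg_comp (fun z => (b z, coord tau z)) (mix e)
    (G := nbhs (b y, coord tau y))).
    apply: (@cvg_pair _ _ _ _ (nbhs (b y)) (nbhs (coord tau y))).
      exact: (smooth_vec_continuous M_atlas (bS y)).
    exact: coord_continuous_at (tauY y Yy) (tauc y Yy).
  exact: (Ck_continuous (Ck_mix e 0)).
exists tau'; split=> //.
- move=> y ty; have [Zy|nZy] := pselect (Z y); last first.
    by apply: (csec_trans K_lie ty); exact: (germ_rel_eq cgc (offZ y nZy)).
  have Yy := ZY y Zy.
  apply: (csec_trans K_lie (sY (nbhs_singleton Yy))).
  exists (cinv c \o H); last exact: near_tau'.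
  apply: filterS Yy => z Yz.
  apply: (cvg_comp H (cinv c)); first exact: contH.
  by apply: (chart_inv_continuous cC); exact: mixc.
- move=> y Yy; rewrite /coord tau'E// fdiv_bact.
  by have [] := chart_invK cC (mixc y Yy).
- move=> y Yy /(@germ_rel_fdiv _ _ _ _ _ _ _ _ _ _ _) fS.
  apply: smooth_case => //.
  have cS := smooth_grp_chart K_lie fS Ac (tauc y (nbhs_singleton Yy)).
  apply: (smooth_vec_comp (smooth_vec_pair M_atlas (bS y) cS)).
  by apply: smooth_nearT => n; exact: Ck_mix.
- move=> y Yy b1; apply: smooth_case => //.
  apply: (@smooth_vec_eq _ _ _ _ _ (fun=> e)); last exact: smooth_vec_cst.
  by apply: filterS b1 => z bz; rewrite /H /mix bz subrr scale0r scale1r add0r.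
Qed.

(** Contractions are iterated over a finite cover of Z. A step uses a constant e that
    lies in D y for all y in the support of its plateau function, so it moves
    coord tau y inside the convex set D y; what earlier steps did at y is irrelevant,
    and no estimate accumulates. *)
Lemma smooth_in_chart (tau1 : M -> P) (D : M -> set E) (Z : set M) :
  (forall y, Y y -> csec tau1 y) ->
  (forall y, Y y -> cdom c (fdiv (s y) (tau1 y)) /\ D y (coord tau1 y)) ->
  (forall y, Y y -> cvx (D y) /\ D y `<=` ccod c) ->
  compact Z -> Z `<=` Y° ->
  (forall y, Z y -> exists e, \forall z \near y, Y z -> D z e) ->
  exists tau : M -> P,
    [/\ forall y, ~ Y y -> tau y = tau1 y,
        forall y, csec tau1 y -> csec tau y,
        forall y, Y y -> cdom c (fdiv (s y) (tau y)) /\ D y (coord tau y),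
        forall y, ~ Y° y -> \forall z \near y, tau1 z = tau z
      & forall y, Y° y -> Z y \/ smooth_rel y s tau1 -> smooth_rel y s tau].
Proof.
move=> tauY tau1D Dcvx Zc ZY De.
pose Inv tau := [/\ forall y, ~ Y y -> tau y = tau1 y,
        forall y, csec tau1 y -> csec tau y,
        forall y, Y y -> cdom c (fdiv (s y) (tau y)) /\ D y (coord tau y),
        forall y, Y° y -> smooth_rel y s tau1 -> smooth_rel y s tau
      & forall y, ~ Y° y -> \forall z \near y, tau1 z = tau z].
pose Pr (B : set M) := forall tau, Inv tau -> exists2 tau', Inv tau' &
  (forall y, Y° y -> smooth_rel y s tau -> smooth_rel y s tau') /\
  (forall y, B y -> Y° y -> smooth_rel y s tau').
suff /(_ tau1)[|tau [h1 h2 h3 h4 h5] [_ tauS]] : Pr Z.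
- by split=> // y _; exact: nearW.
- by exists tau; split=> // y Yy [Zy|]; [exact: tauS|exact: h4].
apply: compact_ind => //.
- by move=> tau It; exists tau => //; split.
- move=> B C PB PC tau /PB[tau2 It2 [p2 s2]]; have [tau3 It3 [p3 s3]] := PC tau2 It2.
  exists tau3 => //; split=> [y Yy /(p2 y Yy)|y [By|Cy] Yy]; first exact: p3.
    by apply: p3 => //; exact: s2.
  exact: s3.
- move=> B C BC PC tau /PC[tau2 It2 [p2 s2]]; exists tau2 => //; split=> // y /BC.
  exact: s2.
move=> x Zx; have [e eD] := De x Zx.
have Yx : nbhs x Y° by apply: nbhs_interior; exact: ZY.
have [Z' [b [[Z'x _ Z'cl Z'N] bS b01 b1 b0]]] :=
  exists_bump M_haus M_atlas (filterI Yx eD).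
exists [set y | \forall z \near y, b z = 1]; first exact: near_join b1.
move=> tau [off csecI inI smI nearI].
have tauYI y : Y y -> csec tau y by move=> /tauY /csecI.
have stay y : Y y -> D y (mix e (b y, coord tau y)).
  move=> Yy; have [Dc _] := Dcvx y Yy; have [_ Dt] := inI y Yy.
  have [Z'y|nZ'y] := pselect (Z' y).
    by apply: (Dc _ _ _ (b01 y) Dt); have [_ h] := Z'N y Z'y; exact: h.
  by rewrite /mix b0//= subr0 scale1r scale0r addr0.
have Z'Y : Z' `<=` Y° by move=> y /Z'N[].
have [tau' [offZ csec' in' sm' one']] := contract_section tauYI
  (fun y Yy => (inI y Yy).1) bS Z'cl Z'Y b0
  (fun y Yy => (Dcvx y Yy).2 _ (stay y Yy)).
exists tau'; last by split=> // y b1y Yy; exact: one'.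
split.
- move=> y nYy; rewrite -off//; apply/esym; apply: (nbhs_singleton (offZ y _)).
  by move=> /Z'Y /interior_subset.
- by move=> y /csecI /csec'.
- by move=> y Yy; have [cy cE] := in' y Yy; rewrite cE; split=> //; exact: stay.
- by move=> y Yy /(smI y Yy); exact: sm'.
- move=> y nYy; have nZ'y : ~ Z' y by move=> /Z'Y.
  by apply: filterS2 (nearI y nYy) (offZ y nZ'y) => z ->.
Qed.

End Contraction.

End Smoothing.

(** * Smoothing a section along a compact set *)

Section SmoothSection.
Context {R : realType} {E : tvsType R} {K : preTopologicalGroupType}
  (AK : set (chart K E)) {d : nat} {M : topologicalType} (AM : set (chart M 'rV[R]_d)).
Hypothesis (K_lie : lie_group AK) (M_haus : hausdorff_space M)
  (M_atlas : smooth_atlas (@corner R d) smooth_sub AM).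
Context {P : principal_bundle K M}.

Local Notation cgc := (cont_grp_class K_lie).
Local Notation sgc := (smooth_grp_class K_lie M_atlas).
Local Notation smooth_rel := (germ_rel (smooth_grp AK AM)).

(** Openness for the topology that the trivializations induce on P. Such sets serve
    as smallness conditions on sections. *)
Definition secopen (G : set P) : Prop :=
  forall (y : M) (s : M -> P) (k : K), csec s y -> G (bact (s y) k) ->
    \forall p \near (y, k), G (bact (s p.1) p.2).

Lemma secopenI (G G' : set P) : secopen G -> secopen G' -> secopen (G `&` G').
Proof.
move=> Go G'o y s k sy [Gy G'y].
by apply: filterS2 (Go y s k sy Gy) (G'o y s k sy G'y) => p.
Qed.

Lemma near_prod (X Y : topologicalType) (x : X) (y : Y) (Q : set X) :
  (\forall z \near x, Q z) -> \forall p \near (x, y), Q p.1.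
Proof. by move=> Qx; exact: (@cvg_fst _ _ (nbhs x) (nbhs y) _ Q Qx). Qed.

Lemma secopen_chart (s : M -> P) (c : chart K E) (Y : set M) (O : set E) :
  AK c -> closed Y -> (forall y, Y y -> csec s y) -> open O ->
  secopen [set p | Y (bproj p) -> cdom c (fdiv (s (bproj p)) p) /\
                                  O (cmap c (fdiv (s (bproj p)) p))].
Proof.
move=> Ac Ycl sY Oo y s1 k0 s1y G0.
have cC := atlasK K_lie Ac.
have s1n := near_prod k0 (csec_near K_lie s1y).
have [Yy|nYy] := pselect (Y y); last first.
  have : nbhs y (~` Y) by apply: open_nbhs_nbhs; split=> //; exact: closed_openC.
  move=> /(near_prod k0) nY; apply: filterS2 s1n nY => p s1p nYp /=.
  by rewrite bproj_bact csec_bproj.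
have sy := sY y Yy.
have sn := near_prod k0 (csec_near K_lie sy).
have fdivE z k : csec s z -> csec s1 z ->
    fdiv (s z) (bact (s1 z) k) = (fdiv (s z) (s1 z) * k)%g.
  by move=> sz s1z; rewrite fdivM// !csec_bproj.
move: G0; rewrite /= bproj_bact csec_bproj// => /(_ Yy).
rewrite fdivE// => -[ck Ok].
have nk : nbhs (fdiv (s y) (s1 y) * k0)%g [set k | cdom c k /\ O (cmap c k)].
  apply: filterI; first exact: (chart_dom_nbhs cC).
  by apply: (chart_continuous cC ck); exact: open_nbhs_nbhs.
have fc : (fdiv (s p.1) (s1 p.1) * p.2)%g @[p --> (y, k0)] -->
    (fdiv (s y) (s1 y) * k0)%g.
  apply: (cvg_mulK K_lie); last exact: cvg_snd.
  apply: (cvg_comp fst (fun z => fdiv (s z) (s1 z)) (G := nbhs y)).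
    exact: cvg_fst.
  exact: (csec_fdiv_continuous K_lie sy s1y).
have {nk}fcn := fc _ nk.
apply: filterS3 s1n sn fcn => p s1p sp h _ /=.
by rewrite bproj_bact csec_bproj// fdivE.
Qed.

(** A tube lemma: the graph of coord tau over the compact set Y lies in the open set of
    admissible values, hence so does a neighborhood of it of uniform convex width O. *)
Lemma uniform_room (s : M -> P) (c : chart K E) (Y : set M) (G : set P) (tau : M -> P) :
  AK c -> compact Y -> (forall y, Y y -> csec s y) -> secopen G ->
  (forall y, Y y -> [/\ csec tau y, G (tau y) & cdom c (fdiv (s y) (tau y))]) ->
  exists O : set E, [/\ open O, cvx O, O 0 &
    forall y v, Y y -> O v -> ccod c (coord s c tau y + v) /\
      G (bact (s y) (cinv c (coord s c tau y + v)))].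
Proof.
move=> Ac Yc sY Go tauY; have cC := atlasK K_lie Ac.
pose Pr (B : set M) := exists O : set E, [/\ open O, cvx O, O 0 &
    forall y v, B y -> Y y -> O v -> ccod c (coord s c tau y + v) /\
      G (bact (s y) (cinv c (coord s c tau y + v)))].
suff [O [Oo Oc O0 OP]] : Pr Y by exists O; split=> // y v Yy; exact: OP.
apply: compact_ind => //.
- by exists setT; split=> //; exact: openT.
- move=> B C [O [Oo Oc O0 OP]] [O' [O'o O'c O'0 O'P]]; exists (O `&` O'); split=> //.
  + exact: openI.
  + by move=> u v t t01 [Ou O'u] [Ov O'v]; split; [exact: Oc|exact: O'c].
  + by move=> y v [By|Cy] Yy [Ov O'v]; [exact: OP|exact: O'P].
- move=> B C BC [O [Oo Oc O0 OP]]; exists O; split=> // y v /BC; exact: OP.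
move=> y0 Yy0; have [ty0 Gy0 cy0] := tauY y0 Yy0.
have codn := chart_cod_nbhs cC (chart_cod cy0).
have ac : (coord s c tau p.1 + p.2) @[p --> (y0, 0 : E)] --> coord s c tau y0.
  rewrite -[X in _ --> X]addr0; apply: cvg_addv; last exact: cvg_snd.
  apply: (cvg_comp fst (coord s c tau) (G := nbhs y0)); first exact: cvg_fst.
  exact: (coord_continuous_at K_lie Ac sY Yy0 ty0 cy0).
have codn' := ac _ codn.
have gc : (p.1, cinv c (coord s c tau p.1 + p.2)) @[p --> (y0, 0 : E)] -->
    (y0, fdiv (s y0) (tau y0)).
  apply: (@cvg_pair _ _ _ _ (nbhs y0) (nbhs (fdiv (s y0) (tau y0)))).
    exact: cvg_fst.
  apply: (cvg_comp (fun p => coord s c tau p.1 + p.2) (cinv c) ac).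
  have := chart_inv_continuous cC (chart_cod cy0).
  by rewrite /prop_for /continuous_at (chartK cC).
have Gn : \forall p \near (y0, fdiv (s y0) (tau y0)), G (bact (s p.1) p.2).
  apply: Go; first exact: sY.
  by rewrite -csec_fdiv//; exact: sY.
have Gn' := gc _ Gn.
have : \forall p \near (y0, 0 : E), ccod c (coord s c tau p.1 + p.2) /\
    G (bact (s p.1) (cinv c (coord s c tau p.1 + p.2))).
  by apply: filterI; [exact: codn'|exact: Gn'].
move=> [[B1 B2] /= [B1n B2n] BP].
have [O [Oo Oc O0 OB]] := open_cvx_nbhs B2n.
exists B1 => //; exists O; split=> // y v By Yy Ov.
by have [] := BP (y, v) (conj By (OB v Ov)).
Qed.

(** Induction over the compact set X, with a statement about all sections close to
    tau0. Near x, every section allowed by G0 can be read in one chart of K, with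
    values in a convex set, and [smooth_in_chart] makes it smooth near x inside any
    smaller condition G. Letting G be arbitrary is what allows two such steps to be
    composed: the second one respects the smallness needed by the first. *)
Lemma smooth_section (sigma : M -> M -> P) (U X : set M) (tau0 : M -> P) :
  (forall x, X x -> csec (sigma x) x) ->
  (forall x, X x -> \forall y \near x, X y -> smooth_rel y (sigma x) (sigma y)) ->
  compact X -> open U -> X `<=` U -> (forall y, U y -> csec tau0 y) ->
  exists tau : M -> P, (forall y, U y -> csec tau y) /\
    forall y, X y -> smooth_rel y (sigma y) tau.
Proof.
move=> sig_sec sig_rel Xc Uo XU tau0U.
pose Pr (B : set M) := exists G0 : set P, [/\ secopen G0,
  forall y, U y -> G0 (tau0 y) &
  forall (G : set P) (tau1 : M -> P), secopen G -> G `<=` G0 ->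
    (forall y, U y -> csec tau1 y /\ G (tau1 y)) ->
    exists tau : M -> P, (forall y, U y -> csec tau y /\ G (tau y)) /\
      forall y, X y -> B y \/ smooth_rel y (sigma y) tau1 ->
        smooth_rel y (sigma y) tau].
suff [G0 [G0o G0t /(_ G0 tau0 G0o (fun _ h => h))[|tau [tU tX]]]] : Pr X.
- by move=> y Uy; split; [exact: tau0U|exact: G0t].
- by exists tau; split=> [y /tU[]|y Xy] //; apply: tX => //; left.
apply: compact_ind => //.
- exists setT; split=> //; first by move=> y s k _ _; exact: filterT.
  move=> G tau1 _ _ tG.
  by exists tau1; split=> // y _ [].
- move=> B C [G1 [G1o G1t G1P]] [G2 [G2o G2t G2P]]; exists (G1 `&` G2); split.
  + exact: secopenI.
  + by move=> y Uy; split; [exact: G1t|exact: G2t].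
  move=> G tau1 Go GG tG.
  have [tau2 [t2U t2X]] := G1P G tau1 Go (subset_trans GG (@subIsetl _ _ _)) tG.
  have [tau3 [t3U t3X]] := G2P G tau2 Go (subset_trans GG (@subIsetr _ _ _)) t2U.
  exists tau3; split=> // y Xy [[By|Cy]|Sy]; apply: t3X => //.
  + by right; apply: t2X => //; left.
  + by left.
  + by right; apply: t2X => //; right.
- move=> B C BC [G0 [G0o G0t G0P]]; exists G0; split=> // G tau1 Go GG tG.
  have [tau [tU tX]] := G0P G tau1 Go GG tG; exists tau; split=> // y Xy [/BC By|Sy].
    by apply: tX => //; left.
  by apply: tX => //; right.
move=> x Xx; pose s := sigma x.
have sx : csec s x by exact: sig_sec.
have t0x : csec tau0 x by apply: tau0U; exact: XU.
have [c Ac cx] := atlasK_cover K_lie (fdiv (s x) (tau0 x)).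
have cC := atlasK K_lie Ac.
have [Om [Omo Omc Omx OmP]] := open_cvx_nbhs (chart_cod_nbhs cC (chart_cod cx)).
have fc := csec_fdiv_continuous K_lie sx t0x.
have n1 : \forall y \near x, cdom c (fdiv (s y) (tau0 y)) /\ Om (coord s c tau0 y).
  have nk : nbhs (fdiv (s x) (tau0 x)) [set k | cdom c k /\ Om (cmap c k)].
    apply: filterI; first exact: (chart_dom_nbhs cC).
    by apply: (chart_continuous cC cx); exact: open_nbhs_nbhs.
  exact: (fc _ nk).
have /(_ _) n2 := filterI (csec_near K_lie sx) (sig_rel x Xx).
have /(_ _ _) n3 := filterI (open_nbhs_nbhs (conj Uo (XU x Xx))) (filterI n1 n2).
have [Y [_ [[Yx Yc Ycl Yn] _ _ _ _]]] := exists_bump M_haus M_atlas n3.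
have [Z [_ [[Zx Zc _ ZY] _ _ _ _]]] := exists_bump M_haus M_atlas (nbhs_interior Yx).
have sY y : Y y -> csec s y by move=> /Yn[_ [_ []]].
have YU y : Y y -> U y by move=> /Yn[].
have srel y : Y y -> X y -> smooth_rel y s (sigma y).
  by move=> /Yn[_ [_ [_ h]]] Xy; exact: h.
exists Z => //.
(* over Y, sections in G0 stay in the chart c, and in the convex set Om *)
pose G0 : set P := [set p | Y (bproj p) -> cdom c (fdiv (s (bproj p)) p) /\
                                  Om (cmap c (fdiv (s (bproj p)) p))].
exists G0; split; first exact: secopen_chart.
  move=> y Uy; rewrite /G0 /= (csec_bproj (tau0U y Uy)) => Yy.
  by have [_ [h _]] := Yn y Yy.
move=> G tau1 Go GG tG.
have t1Y y : Y y -> [/\ csec tau1 y, G (tau1 y) & cdom c (fdiv (s y) (tau1 y))].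
  move=> Yy; have [ty Gy] := tG y (YU y Yy); split=> //.
  by have := GG _ Gy; rewrite /G0 /= csec_bproj// => /(_ Yy)[].
have [O [Oo Oc O0 OP]] := uniform_room Ac Yc sY Go t1Y.
(* coord tau1 y0 lies in D y for y near y0, by continuity of coord tau1 *)
pose D y : set E := [set e | O (e - coord s c tau1 y)].
have [|y Yy|y Yy|y Zy|tau [tY tsec_ tin tnear tS]] :=
  smooth_in_chart K_lie M_haus M_atlas Ac sY (tau1 := tau1) (D := D) _ _ _ Zc ZY.
- by move=> y /t1Y[].
- by have [] := t1Y y Yy; split=> //; rewrite /D /= subrr.
- split=> [u v t t01 Du Dv|u Du].
    rewrite /D /=; have := Oc _ _ t t01 Du Dv; congr O.
    rewrite !scalerBr addrACA; congr (_ + _).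
    by rewrite -opprD -scalerDl subrK scale1r.
  by have [+ _] := OP y _ Yy Du; rewrite addrC subrK.
- exists (coord s c tau1 y); have Yy := interior_subset (ZY y Zy).
  have [ty _ cy] := t1Y y Yy.
  have h : (coord s c tau1 y - coord s c tau1 z) @[z --> y] --> (0 : E).
    rewrite -[X in _ --> X](subrr (coord s c tau1 y)).
    apply: cvg_subv; first exact: cvg_cst.
    exact: (coord_continuous_at K_lie Ac sY Yy ty cy).
  have := h _ (open_nbhs_nbhs (conj Oo O0)).
  by rewrite /= !near_simpl; apply: filterS => z.
exists tau; split=> [y Uy|y Xy By].
  have [t1y G1y] := tG y Uy; split; first exact: tsec_.
  have [Yy|nYy] := pselect (Y y); last by rewrite tY.
  have [cy Dy] := tin y Yy.
  have [_] := OP y _ Yy Dy; rewrite [coord s c tau1 y + _]addrC subrK.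
  by rewrite /coord (chartK cC)// -csec_fdiv//; [exact: sY|exact: tsec_].
have [Yy|nYy] := pselect (Y° y); last first.
  case: By => [/ZY//|h]; apply: (germ_rel_trans sgc h).
  exact: (germ_rel_eq sgc (tnear y nYy)).
have sy := srel y (interior_subset Yy) Xy.
apply: (germ_rel_trans sgc (germ_rel_sym sgc sy)).
apply: tS => //; case: By => [|h]; [by left|right].
exact: (germ_rel_trans sgc sy).
Qed.

End SmoothSection.

(** * Extending smooth structures *)

Section Extension.
Context {R : realType} {E : tvsType R} {K : preTopologicalGroupType}
  (AK : set (chart K E)) {d : nat} {M : topologicalType} (AM : set (chart M 'rV[R]_d)).
Hypothesis (K_lie : lie_group AK) (M_haus : hausdorff_space M)
  (M_atlas : smooth_atlas (@corner R d) smooth_sub AM) (M_para : paracompact M).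
Context {P : principal_bundle K M}.

Local Notation cgc := (cont_grp_class K_lie).
Local Notation sgc := (smooth_grp_class K_lie M_atlas).
Local Notation smooth_rel := (germ_rel (smooth_grp AK AM)).

(** A smooth structure on the germ of P along A. As A need not be open, structures
    along closed sets can be glued without passing to smaller neighborhoods. *)
Definition smooth_str (A : set M) (sigma : M -> M -> P) : Prop :=
  (forall x, A x -> csec (sigma x) x) /\
  (forall x, A x -> \forall y \near x, A y -> smooth_rel y (sigma x) (sigma y)).

(** Once tau is smooth at the points common to A and F, the new structure is given by
    sigma on A and by tau on the rest of F: away from F only sigma matters since F is
    closed, and away from A only tau does since A is closed. *)
Lemma extend_str (A F U : set M) (sigma : M -> M -> P) (tau0 : M -> P) :
  closed A -> closed F -> compact F -> open U -> F `<=` U ->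
  (forall y, U y -> csec tau0 y) -> smooth_str A sigma ->
  exists sigma', smooth_str (A `|` F) sigma' /\ forall x, A x -> sigma' x = sigma x.
Proof.
move=> Acl Fcl Fc Uo FU tau0U [sS sR].
have XU : A `&` F `<=` U by move=> x [_ /FU].
have Xc : compact (A `&` F) by rewrite setIC; exact: compact_closedI.
have [x [Ax _]|x [Ax _]|tau [tauU tauX]] :=
  smooth_section K_lie M_haus M_atlas (sigma := sigma) _ _ Xc Uo XU tau0U.
- exact: sS.
- by apply: filterS (sR x Ax) => y h [/h].
pose sigma' x := if `[< A x >] then sigma x else tau.
have sA x : A x -> sigma' x = sigma x by rewrite /sigma'; case: asboolP.
have snA x : ~ A x -> sigma' x = tau by rewrite /sigma'; case: asboolP.
have nearC (B : set M) x : closed B -> ~ B x -> \forall y \near x, ~ B y.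
  by move=> Bcl nBx; apply: open_nbhs_nbhs; split=> //; exact: closed_openC.
exists sigma'; split=> //; split=> x ABx.
  have [Ax|nAx] := pselect (A x); first by rewrite sA//; exact: sS.
  by rewrite snA//; case: ABx => // Fx; apply: tauU; exact: FU.
have [Ax|nAx] := pselect (A x); last first.
  rewrite snA//; apply: filterS (nearC A x Acl nAx) => y nAy _.
  by rewrite snA//; exact: (germ_rel_refl sgc).
rewrite sA//.
have nF : \forall y \near x, F y -> smooth_rel y (sigma x) tau.
  have [Fx|nFx] := pselect (F x); last by apply: filterS (nearC F x Fcl nFx).
  by apply: filterS (germ_rel_near sgc (tauX x (conj Ax Fx))) => y h _.
apply: filterS2 (sR x Ax) nF => y hA hF ABy.
have [Ay|nAy] := pselect (A y); first by rewrite sA//; exact: hA.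
by rewrite snA//; case: ABy => // /hF.
Qed.

Lemma finite_chain (T : Type) (I : eqType) (S : set T) (f : T -> set I)
    (p0 : T) (D : set I) :
  S p0 -> (forall s t, S s -> S t -> f s `<=` f t \/ f t `<=` f s) ->
  finite_set D -> D `<=` \bigcup_(p in S) f p -> exists2 p, S p & D `<=` f p.
Proof.
move=> Sp0 tot /finite_seqP[r ->]; elim: r => [|i r IH] rS; first by exists p0.
have [|p Sp rp] := IH; first by move=> j /= jr; apply: rS; rewrite /= inE jr orbT.
have [|q Sq qi] := rS i; first by rewrite /= inE eqxx.
have [pq|qp] := tot p q Sp Sq.
  by exists q => // j; rewrite /= inE => /orP[/eqP->//|/rp/pq].
by exists p => // j; rewrite /= inE => /orP[/eqP->|/rp//]; exact: qp.
Qed.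

(** Zorn's lemma over the subfamilies of a locally finite cover: local finiteness
    keeps the closed sets closed and reduces every germ in a union of a chain to a
    germ in one of its members. *)
Lemma extend_str_all (A0 : set M) (sigma0 : M -> M -> P) :
  closed A0 -> smooth_str A0 sigma0 ->
  exists sigma, smooth_str setT sigma /\ forall x, A0 x -> sigma x = sigma0 x.
Proof.
move=> A0cl str0.
pose U0 := [set O : set M | open O /\ exists F U (tau : M -> P),
  [/\ closed F /\ compact F, open U, O `<=` F, F `<=` U & forall y, U y -> csec tau y]].
have U0cov x : exists2 O, U0 O & O x.
  have [t tP tx] := exists_triv (P := P) x; have [to _ _ _] := tP.
  have [Z [_ [[Zx Zc Zcl ZN] _ _ _ _]]] :=
    exists_bump M_haus M_atlas (open_nbhs_nbhs (conj to tx)).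
  exists Z°; last exact: Zx.
  split; first exact: open_interior.
  exists Z, (tdom t), (tsec t); split=> //.
    exact: interior_subset.
  by move=> y ty; exact: (csec_tsec K_lie).
have [W [Wo Wcov WU0 Wlf]] := M_para (fun O => @proj1 _ _) U0cov.
pose AJ (J : set (set M)) := A0 `|` \bigcup_(B in J) closure B.
have AJcl J : J `<=` W -> closed (AJ J).
  by move=> JW; apply: closedU => //; exact: loc_finite_closed Wlf JW.
have AJS J J' : J `<=` J' -> AJ J `<=` AJ J'.
  move=> JJ' x [A0x|[B JB Bx]]; [by left|right].
  by exists B => //; exact: JJ'.
pose ok (p : set (set M) * (M -> M -> P)) :=
  [/\ p.1 `<=` W, smooth_str (AJ p.1) p.2 & forall x, A0 x -> p.2 x = sigma0 x].
pose T := {p : set (set M) * (M -> M -> P) | ok p}.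
have ok0 : ok (set0, sigma0).
  by split=> //=; rewrite /AJ bigcup_set0 setU0.
pose Rr (p q : T) := `[< (sval p).1 `<=` (sval q).1 /\
  forall x, AJ (sval p).1 x -> (sval q).2 x = (sval p).2 x >].
have RrP p q : Rr p q <-> ((sval p).1 `<=` (sval q).1 /\
    forall x, AJ (sval p).1 x -> (sval q).2 x = (sval p).2 x).
  by split=> [/asboolP|] // h; exact/asboolP.
have [|r s t /RrP[rs rsE] /RrP[st stE]|S Stot|p pmax] :=
  @ZL_preorder T (exist ok _ ok0) Rr.
- by move=> p; apply/RrP; split.
- apply/RrP; split=> [|x rx]; first exact: subset_trans st.
  by rewrite stE ?rsE//; exact: AJS rx.
- have [[p0 Sp0]|S0] := pselect (exists p, S p); last first.
    by exists (exist ok _ ok0) => s Ss; exfalso; apply: S0; exists s.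
  pose J := \bigcup_(p in S) (sval p).1.
  have JW : J `<=` W by move=> B [p Sp pB]; have [pW _ _] := svalP p; exact: pW.
  have /choice[sigma sigmaP] : forall x, exists sx : M -> P,
      forall p, S p -> AJ (sval p).1 x -> sx = (sval p).2 x.
    move=> x; have [[p [Sp px]]|nx] := pselect (exists p, S p /\ AJ (sval p).1 x).
      exists ((sval p).2 x) => q Sq qx.
      have [/RrP[_ h]|/RrP[_ h]] := Stot p q Sp Sq; last exact: h.
      by rewrite h.
    by exists (sigma0 x) => p Sp px; exfalso; apply: nx; exists p.
  have local (x : M) : exists2 p, S p & \forall y \near x, AJ J y -> AJ (sval p).1 y.
    have [N Nx Nfin] := Wlf x.
    have [|||p Sp pD] := @finite_chain T (set M) S (fun p => (sval p).1) p0
      [set B | J B /\ B `&` N !=set0] Sp0.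
    + move=> s t Ss St.
      by have [/RrP[st _]|/RrP[ts _]] := Stot s t Ss St; [left|right].
    + by apply: sub_finite_set Nfin => B [/JW WB BN].
    + by move=> B [].
    exists p => //; apply: filterS (nbhs_interior Nx) => y Ny [A0y|[B JB By]].
      by left.
    by right; exists B => //; apply: pD; split=> //; exact: By.
  have okJ : ok (J, sigma).
    split=> //=; last first.
      move=> x A0x; rewrite (sigmaP x p0 Sp0); last by left.
      by have [_ _ h] := svalP p0; exact: h.
    split=> x Jx; have [p Sp nearp] := local x; have [_ [sS sR] _] := svalP p.
      have px := nbhs_singleton nearp Jx.
      by rewrite (sigmaP x p Sp px); exact: sS.
    have px := nbhs_singleton nearp Jx; rewrite (sigmaP x p Sp px).
    apply: filterS2 nearp (sR x px) => y pJ h Jy; have py := pJ Jy.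
    by rewrite (sigmaP y p Sp py); exact: h.
  exists (exist ok _ okJ) => s Ss; apply/RrP; split=> /= [B sB|x sx]; first by exists s.
  exact: sigmaP.
have [pW pstr p0E] := svalP p.
exists (sval p).2; split=> //.
suff -> : setT = AJ (sval p).1 by [].
apply/seteqP; split=> // x _; apply: contrapT => npx.
have [B WB Bx] := Wcov x.
have [O [Oo [F [U [tau [[Fcl Fc] Uo OF FU tauU]]]]] BO] := WU0 B WB.
have BF : closure B `<=` F.
  rewrite [X in _ `<=` X](closure_id F).1//; apply: closureS.
  exact: subset_trans OF.
have Bcl : closed (closure B) by exact: closed_closure.
have [sigma [sstr sE]] := extend_str (AJcl _ pW) Bcl (subclosed_compact Bcl Fc BF) Uo
  (subset_trans BF FU) tauU pstr.
have AJE : AJ ((sval p).1 `|` [set B]) = AJ (sval p).1 `|` closure B.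
  by rewrite /AJ bigcup_setU bigcup_set1 setUA.
have okq : ok ((sval p).1 `|` [set B], sigma).
  split=> /=.
  - by move=> B' [/pW//|->].
  - by rewrite AJE.
  - by move=> y A0y; rewrite sE ?p0E//; left.
have /pmax /RrP[/= qp _] : Rr p (exist ok _ okq).
  by apply/RrP; split=> /= [B' pB'|]; [left|].
by apply: npx; right; exists B; [apply: qp; right|exact: subset_closure].
Qed.

End Extension.

(** * Trivializations given by sections *)

Section SmoothTrivializations.
Context {R : realType} {E : tvsType R} {K : preTopologicalGroupType}
  (AK : set (chart K E)) {d : nat} {M : topologicalType} (AM : set (chart M 'rV[R]_d)).
Hypothesis (K_lie : lie_group AK) (M_atlas : smooth_atlas (@corner R d) smooth_sub AM).
Context {P : principal_bundle K M}.

Definition section_triv (O : set M) (s : M -> P) : loc_triv K M P :=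
  LocTriv O (fun p => (bproj p, fdiv (s (bproj p)) p)) (fun q => bact (s q.1) q.2).

Lemma tsec_section_triv O s : tsec (section_triv O s) = s.
Proof. by apply/funext => y; rewrite /tsec /= bact1. Qed.

(** The inclusion of O in the domain of one trivialization controls the topology of P
    over O, so that continuity can be checked in that trivialization. *)
Lemma section_trivP (O : set M) (s : M -> P) (t : loc_triv K M P) :
  is_loc_triv (@bact K M P) (@bproj K M P) t ->
  open O -> O `<=` tdom t -> (forall y, O y -> csec s y) ->
  is_loc_triv (@bact K M P) (@bproj K M P) (section_triv O s).
Proof.
move=> tP Oo Ot sO; have [to [_ _ tc ic] _ _] := tP.
have OTo : open (O `*` [set: K]) by exact: open_prodT.
split=> //=; last first.
  by move=> p k Op; rewrite bproj_bact fdivM// csec_bproj//; exact: sO.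
split=> /=.
- by move=> p Op; split=> //; rewrite bact_fdiv// csec_bproj//; exact: sO.
- move=> [y k] [/= Oy _]; have sy := csec_bproj (sO y Oy).
  by rewrite bproj_bact sy fdiv_bact.
- pose g (q : M * K) := (q.1, (fdiv (s q.1) (tsec t q.1) * q.2)%g).
  apply/subspace_continuousP => p Op; have tp := Ot _ Op.
  have gE p' : O (bproj p') -> g (tmap t p') = (bproj p', fdiv (s (bproj p')) p').
    move=> Op'; have tp' := Ot _ Op'; have [_ _ e _] := tP.
    rewrite /g e//; congr pair; rewrite -fdivM.
      by rewrite -tmap_tsec.
    by rewrite bproj_tsec// csec_bproj//; exact: sO.
  have c1 : tmap t @ within (@bproj K M P @^-1` O) (nbhs p) --> tmap t p.
    move/subspace_continuousP: tc => /(_ p tp); apply: cvg_trans.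
    by apply: cvg_app; apply: within_subset => // q /Ot.
  have c2 : g @ nbhs (tmap t p) --> g (tmap t p).
    have e1 : (tmap t p).1 = bproj p by have [_ _ e _] := tP; exact: e.
    have Op1 : O (tmap t p).1 by rewrite e1.
    apply: (@cvg_pair _ _ _ _ (nbhs (tmap t p).1) (nbhs (fdiv _ _ * _)%g)).
      exact: cvg_fst.
    apply: (cvg_mulK K_lie); last exact: cvg_snd.
    apply: (cvg_comp fst (fun y => fdiv (s y) (tsec t y)) (G := nbhs (tmap t p).1)).
      exact: cvg_fst.
    apply: (csec_fdiv_continuous K_lie); first exact: sO.
    by apply: (csec_tsec K_lie) => //; exact: Ot.
  have := cvg_comp _ _ c1 c2; rewrite gE//; apply: cvg_trans; apply: near_eq_cvg.
  by apply: filterS (withinT _ _) => q /gE /= ->.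
- apply: openP_within => // -[y k] [/= Oy _].
  have ty := Ot y Oy.
  have bE z k' : O z -> bact (s z) k' = tinv t (z, (fdiv (tsec t z) (s z) * k')%g).
    move=> Oz; rewrite -bact_tsec//; last exact: Ot.
    by rewrite -bactM -csec_fdiv//; [apply: (csec_tsec K_lie) => //; exact: Ot|exact: sO].
  have c1 : (q.1, (fdiv (tsec t q.1) (s q.1) * q.2)%g) @[q --> (y, k)] -->
      (y, (fdiv (tsec t y) (s y) * k)%g).
    apply: (@cvg_pair _ _ _ _ (nbhs y) (nbhs (fdiv _ _ * _)%g)); first exact: cvg_fst.
    apply: (cvg_mulK K_lie); last exact: cvg_snd.
    apply: (cvg_comp fst (fun y => fdiv (tsec t y) (s y)) (G := nbhs y)).
      exact: cvg_fst.
    apply: (csec_fdiv_continuous K_lie); last exact: sO.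
    by apply: (csec_tsec K_lie).
  have c2 := within_openP (open_prodT to) ic (conj ty I :
    (tdom t `*` setT) (y, (fdiv (tsec t y) (s y) * k)%g)).
  rewrite /prop_for /continuous_at /= bE//.
  have := cvg_comp _ _ c1 c2; apply: cvg_trans; apply: near_eq_cvg.
  by apply: filterS (near_prod k (open_nbhs_nbhs (conj Oo Oy))) => q Oq /=; rewrite bE.
Qed.

Lemma smooth_transition_rel (Q : principal_bundle K M) (W : set M)
    (t t' : loc_triv K M Q) : open W ->
  smooth_transition AM AK (idfun : Q -> Q) W t t' ->
  forall y, W y -> germ_rel (smooth_grp AK AM) y (tsec t) (tsec t').
Proof.
move=> Wo [k kE /(smooth_map_grpP K_lie M_atlas _ Wo) kS] y Wy; exists k; first exact: kS.
by apply: filterS (open_nbhs_nbhs (conj Wo Wy)) => z /kE.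
Qed.

Lemma rel_smooth_transition (W : set M) (t t' : loc_triv K M P) : open W ->
  (forall y, W y -> csec (tsec t) y /\ csec (tsec t') y) ->
  (forall y, W y -> germ_rel (smooth_grp AK AM) y (tsec t) (tsec t')) ->
  smooth_transition AM AK (idfun : P -> P) W t t'.
Proof.
move=> Wo Wc Wr; exists (fun y => fdiv (tsec t y) (tsec t' y)).
  by move=> y Wy; have [ty t'y] := Wc y Wy; rewrite -csec_fdiv.
by apply/(smooth_map_grpP K_lie M_atlas _ Wo) => y Wy; exact/germ_rel_fdiv/Wr.
Qed.

End SmoothTrivializations.

(** * Smooth structures on continuous bundles *)

Theorem theorem2p11 (R : realType)
    (E : tvsType R) (K : preTopologicalGroupType) (AK : set (chart K E))
    (K_lie : lie_group AK)
    (d : nat) (M : topologicalType) (AM : set (chart M 'rV[R]_d))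
    (M_manifold : manifold_with_corners AM) (M_connected : connected [set: M])
    (P : principal_bundle K M)
    (C : set M) (C_closed : closed C)
    (V : set M) (V_open : open V) (C_sub_V : C `<=` V)
    (L : set (loc_triv K M P)) (P_smooth_on_V : smooth_bundle_on AM AK V L) :
  exists (T : set M) (Q : principal_bundle K M) (LQ : set (loc_triv K M Q))
         (iota : P -> Q),
    [/\ [/\ open T, C `<=` T & T `<=` V],
        smooth_bundle_on AM AK setT LQ,
        extends_restriction AM AK T L LQ iota
      & exists Omega : P -> Q,
          bundle_equivalence Omega /\
          forall p, T (bproj p) -> Omega p = iota p].
Proof.
have [M_para M_haus M_atlas] := M_manifold.
have [[LP LV LVcov] Lsmooth] := P_smooth_on_V.
have sgc := smooth_grp_class K_lie M_atlas.
have [T [To CT TV]] : exists T, [/\ open T, C `<=` T & closure T `<=` V].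
  apply: paracompact_normal => // x N /(exists_bump M_haus M_atlas).
  by move=> [Z [_ [[Zx _ Zcl ZN] _ _ _ _]]]; exists Z.
have TclT : T `<=` closure T by exact: subset_closure.
have /choice[t0 t0P] x : exists t : loc_triv K M P,
    [/\ is_loc_triv (@bact K M P) (@bproj K M P) t, tdom t x & V x -> L t].
  have [/LVcov[t Lt tx]|nVx] := pselect (V x); first by exists t; split=> //; exact: LP.
  by have [t tP tx] := exists_triv (P := P) x; exists t.
have Lrel t t' y : L t -> L t' -> tdom t y -> tdom t' y ->
    germ_rel (smooth_grp AK AM) y (tsec t) (tsec t').
  move=> Lt Lt' ty t'y; have [to _ _ _] := LP t Lt; have [t'o _ _ _] := LP t' Lt'.
  apply: (smooth_transition_rel K_lie M_atlas (openI to t'o) (Lsmooth t t' Lt Lt')).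
  by split.
have str0 : smooth_str AK AM (closure T) (fun x => tsec (t0 x)).
  split=> x clx; have [tP tx /(_ (TV x clx)) Lt] := t0P x.
    exact: (csec_tsec K_lie).
  have [to _ _ _] := tP.
  apply: filterS (open_nbhs_nbhs (conj to tx)) => y ty cly.
  by have [_ t'y /(_ (TV y cly)) Lt'] := t0P y; exact: Lrel.
have [sigma [[sS sR] sE]] := extend_str_all K_lie M_haus M_atlas M_para
  (@closed_closure _ T) str0.
pose good x := [set y | [/\ tdom (t0 x) y, csec (sigma x) y &
  germ_rel (smooth_grp AK AM) y (sigma x) (sigma y)]].
pose O x := (good x)°.
have Oo x : open (O x) by exact: open_interior.
have Og x : O x `<=` good x by exact: interior_subset.
have Ox x : O x x.
  have [tP tx _] := t0P x; have [to _ _ _] := tP.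
  have n1 := open_nbhs_nbhs (conj to tx); have n2 := csec_near K_lie (sS x I).
  by apply: filterS3 n1 n2 (sR x I) => y ty sy h; split=> //; exact: h.
pose nt x := section_triv (O x) (sigma x).
pose LQ : set (loc_triv K M P) := range nt.
have tsec_nt x : tsec (nt x) = sigma x by exact: tsec_section_triv.
exists T, P, LQ, idfun; split.
- by split=> // x /TclT; exact: TV.
- split.
    split=> [_ [x _ <-]|//|x _]; last by exists (nt x); [exists x|exact: Ox].
    have [tP _ _] := t0P x.
    by apply: (section_trivP K_lie tP) => // y /Og[].
  move=> _ _ [x _ <-] [x' _ <-].
  apply: (rel_smooth_transition K_lie M_atlas); first by apply: openI; exact: Oo.
    by move=> y [/Og[_ sy _] /Og[_ s'y _]]; rewrite !tsec_nt.
  move=> y [/Og[_ _ sy] /Og[_ _ s'y]]; rewrite !tsec_nt.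
  exact: (germ_rel_trans sgc sy (germ_rel_sym sgc s'y)).
- split=> //.
  + split=> [p q _ _ //||A Ao _]; last by rewrite image_id.
    by apply: continuous_subspaceT => p; exact: cvg_id.
  + by move=> q k [p Tp <-]; exists (bact p k) => //=; rewrite bproj_bact.
  move=> t _ Lt [x _ <-]; have tP := LP t Lt; have [to _ _ _] := tP.
  apply: (rel_smooth_transition K_lie M_atlas).
  + by apply: openI; [exact: openI|exact: Oo].
  + move=> y [[Ty ty] /Og[_ sy _]]; rewrite tsec_nt; split=> //.
    exact: (csec_tsec K_lie).
  + move=> y [[Ty ty] /Og[_ _ sy]]; rewrite tsec_nt.
    have [_ t'y /(_ (TV y (TclT y Ty))) Lt'] := t0P y.
    apply: (germ_rel_trans sgc (Lrel _ _ _ Lt Lt' ty t'y)).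
    by rewrite -sE; [exact: (germ_rel_sym sgc)|exact: TclT].
- have idb : bundle_map (idfun : P -> P) by split=> // p; exact: cvg_id.
  by exists idfun; split=> //; split=> //; exists idfun.
Qed.
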